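(* Up to normalization factors depending only on the levels $k_1,k_2$, the states $\omega$ and $\mathsf W$ are equal to $\int_\gamma\mathcal P(z)^{-1/M}\varsigma_1(z)dz$ and $\int_\gamma\mathcal P(z)^{-2/M}\varsigma_2(z)dz$ respectively. Namely (for levels such that all denominators below are nonzero), $$\omega=\frac{k_1k_2}{(k_1+k_2+M)(k_1+k_2)(k_1+k_2-M)}\;\frac{\int_\gamma\mathcal P(z)^{-1/M}\varsigma_1(z)dz}{\int_\gamma\mathcal P(z)^{-1/M}dz},$$ $$\mathsf W=\frac{C(k_1,k_2)\,(-\tfrac2Mk_1)_3\,(-\tfrac2Mk_2)_3}{(-\tfrac2Mk_1-\tfrac2Mk_2+1)_3}\;\frac{\int_\gamma\mathcal P(z)^{-2/M}\varsigma_2(z)dz}{\int_\gamma\mathcal P(z)^{-2/M}dz}.$$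
   Context: Work over $\mathbb C$. Fix an integer $M\ge 3$ and let $(X|Y)=\operatorname{tr}(XY)$ on $\mathfrak{sl}_M$ (trace in the defining $M\times M$ representation). The affine algebra $\widehat{\mathfrak{sl}}_M=\mathfrak{sl}_M[t,t^{-1}]\oplus\mathbb C\mathsf k$ has $\mathsf k$ central and, with $a_n:=a\otimes t^n$, $[a_m,b_n]=[a,b]_{m+n}-n\,\delta_{m+n,0}(a|b)\mathsf k$. Let $k_1,k_2\in\mathbb C\setminus\{-M\}$, and take two marked points $z_1=0$, $z_2=1$. $A^{(i)}$ denotes the copy of $A$ in the $i$-th summand of $\widehat{\mathfrak{sl}}_M^{\oplus2}$, and $A(z):=\frac{A^{(1)}}{z}+\frac{A^{(2)}}{z-1}$. $\mathbb V_0^{\bm k}$ is the $\widehat{\mathfrak{sl}}_M^{\oplus2}$-module induced from the one-dimensional module $\mathbb C|0\rangle^{\bm k}$ over $(\mathfrak{sl}_M[t]\oplus\mathbb C\mathsf k)^{\oplus2}$ on which $\mathsf k^{(i)}$ acts as $k_i$ and $a^{(i)}_n$, $n\ge0$, as $0$. Let $I^a=I_a$ be a basis of $\mathfrak{sl}_M$ with $(I_a|I_b)=\delta_{ab}$; repeated Lie indices are summed; $t_{abc}:=\operatorname{tr}(I_aI_bI_c+I_bI_aI_c)$. Define $\varsigma_1(z)=\tfrac12I^a_{-1}(z)I^a_{-1}(z)|0\rangle^{\bm k}$, $\varsigma_2(z)=\tfrac13t_{abc}I^a_{-1}(z)I^b_{-1}(z)I^c_{-1}(z)|0\rangle^{\bm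 k}$, and $\mathcal P(z)=z^{k_1}(z-1)^{k_2}$. $\gamma$ is a Pochhammer contour around $0$ and $1$ (along which powers of $\mathcal P$ have univalued branches; the same branch is used in numerator and denominator). $(a)_n:=a(a-1)\cdots(a-n+1)$ is the falling factorial. $$\omega:=\tfrac{1}{2(k_1+M)}I^{a(1)}_{-1}I^{a(1)}_{-1}|0\rangle^{\bm k}+\tfrac{1}{2(k_2+M)}I^{a(2)}_{-1}I^{a(2)}_{-1}|0\rangle^{\bm k}-\tfrac{1}{2(k_1+k_2+M)}(I^{a(1)}_{-1}+I^{a(2)}_{-1})(I^{a(1)}_{-1}+I^{a(2)}_{-1})|0\rangle^{\bm k}.$$ With $\kappa_i:=-\tfrac2Mk_i$, $$\mathsf W:=C(k_1,k_2)\,t_{abc}\Big(\tfrac13\kappa_2(\kappa_2-1)(\kappa_2-2)\,I^{a(1)}_{-1}I^{b(1)}_{-1}I^{c(1)}_{-1}-(\kappa_1-2)(\kappa_2-1)(\kappa_2-2)\,I^{a(1)}_{-1}I^{b(1)}_{-1}I^{c(2)}_{-1}$$ $$\qquad+(\kappa_1-1)(\kappa_1-2)(\kappa_2-2)\,I^{a(1)}_{-1}I^{b(2)}_{-1}I^{c(2)}_{-1}-\tfrac13\kappa_1(\kappa_1-1)(\kappa_1-2)\,I^{a(2)}_{-1}I^{b(2)}_{-1}I^{c(2)}_{-1}\Big)|0\rangle^{\bm k},$$ where $$C(k_1,k_2):=-\frac{M^3}{4}\frac{D(k_1,k_2)}{(k_1+M)(k_2+M)(k_1+k_2+M)},\qquad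 D(k_1,k_2)^2:=\frac{-M}{2(M+2k_1)(M+2k_2)(3M+2k_1+2k_2)(M^2-4)},$$ with any fixed choice of the square root $D(k_1,k_2)$. *)

(* Defs.v *)
From HB Require Import structures.
From mathcomp Require Import all_boot all_order all_algebra.
From mathcomp Require Import complex.
From mathcomp Require Import all_classical all_reals all_analysis.

Set Implicit Arguments.
Unset Strict Implicit.
Unset Printing Implicit Defensive.

Import Order.TTheory GRing.Theory Num.Theory.
Import numFieldNormedType.Exports.
Import complex.

Local Open Scope classical_set_scope.
Local Open Scope complex_scope.
Local Open Scope ring_scope.

Section LieAlgebra.
Variables (R : realType) (M : nat).
Local Notation C := R[i].

Definition sl_space : {vspace 'M[C]_M} :=
  lker (linfun (mxtrace : 'M[C]_M -> C^o)).

Definition sl := subvs_of sl_space.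

(* A commutator has trace 0, so the projection onto sl_space does not change
   it; it only serves to land in the type sl. *)
Definition sl_bracket (a b : sl) : sl :=
  vsproj sl_space (vsval a *m vsval b - vsval b *m vsval a).

Definition sl_form (a b : sl) : C := \tr (vsval a *m vsval b).

Definition sl_t (a b c : sl) : C :=
  \tr (vsval a *m vsval b *m vsval c + vsval b *m vsval a *m vsval c).

Definition orthonormal_basis (n : nat) (I : n.-tuple sl) : Prop :=
  basis_of fullv I /\
  forall a b : 'I_n, sl_form (tnth I a) (tnth I b) = (a == b)%:R.

(* Modules over the direct sum of two copies (indexed by 'I_2) of the affine
   algebra sl_M[t,t^-1] (+) C k.  The latter being the direct sum of its
   subspaces sl_M (x) t^n and C k, a linear map from it to End(V) is a family
   of linear maps, one on each of these: [mode i n a] is the action of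
   a_n = a (x) t^n, and [central i] that of k, in the i-th summand. *)
Record affine_module := AffineModule {
  affine_carrier :> lmodType C;
  mode : 'I_2 -> int -> sl -> {linear affine_carrier -> affine_carrier};
  central : 'I_2 -> {linear affine_carrier -> affine_carrier};
  mode_linear : forall i n v, linear (fun a => mode i n a v);
  central_mode : forall i j n a v,
    central i (mode j n a v) = mode j n a (central i v);
  central_central : forall i j v,
    central i (central j v) = central j (central i v);
  mode_mode : forall i j m n a b v,
    mode i m a (mode j n b v) - mode j n b (mode i m a v) =
    if i == j then
      mode i (m + n) (sl_bracket a b) v
      - (n%:~R * (m + n == 0)%:R * sl_form a b) *: central i v
    else 0
}.

Definition level (k1 k2 : C) (i : 'I_2) : C := if i == ord0 then k1 else k2.

(* [w] spans a quotient of the one-dimensional module of levels k1, k2 over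
   the subalgebra (sl_M[t] (+) C k)^(+)2. *)
Definition vacuum_vector (k1 k2 : C) (W : affine_module) (w : W) : Prop :=
  (forall i, central W i w = level k1 k2 i *: w) /\
  (forall i (n : int) a, 0 <= n -> mode W i n a w = 0).

Definition intertwiner (V W : affine_module) (f : {linear V -> W}) : Prop :=
  (forall i n a v, f (mode V i n a v) = mode W i n a (f v)) /\
  (forall i v, f (central V i v) = central W i (f v)).

(* The induced module, through Frobenius reciprocity, which determines the
   pair (V, vac) up to a unique isomorphism. *)
Definition induced_vacuum_module (k1 k2 : C) (V : affine_module) (vac : V) :
    Prop :=
  vacuum_vector k1 k2 vac /\
  forall (W : affine_module) (w : W), vacuum_vector k1 k2 w ->
    exists f : {linear V -> W},
      [/\ intertwiner f, f vac = w &
          forall g : {linear V -> W}, intertwiner g -> g vac = w -> g =1 f].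

End LieAlgebra.

Arguments mode {R M a} : rename.
Arguments central {R M a} : rename.

Section States.
Variables (R : realType) (M : nat) (V : affine_module R M) (vac : V).
Variables (n : nat) (I : n.-tuple (sl R M)).
Local Notation C := R[i].

Definition marked_point (i : 'I_2) : C := (i : nat)%:R.

Definition modez (z : C) (m : int) (a : sl R M) (v : V) : V :=
  \sum_(i < 2) (z - marked_point i)^-1 *: mode i m a v.

Definition varsigma1 (z : C) : V :=
  2^-1 *: \sum_(a < n)
    modez z (-1) (tnth I a) (modez z (-1) (tnth I a) vac).

Definition varsigma2 (z : C) : V :=
  3^-1 *: \sum_(a < n) \sum_(b < n) \sum_(c < n)
    sl_t (tnth I a) (tnth I b) (tnth I c) *:
    modez z (-1) (tnth I a) (modez z (-1) (tnth I b)
      (modez z (-1) (tnth I c) vac)).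

Local Notation J1 a := (mode (ord0 : 'I_2) (-1) (tnth I a)).
Local Notation J2 a := (mode (ord_max : 'I_2) (-1) (tnth I a)).

Definition omega_state (k1 k2 : C) : V :=
  \sum_(a < n)
    ((2 * (k1 + M%:R))^-1 *: J1 a (J1 a vac)
     + (2 * (k2 + M%:R))^-1 *: J2 a (J2 a vac)
     - (2 * (k1 + k2 + M%:R))^-1 *:
         (J1 a (J1 a vac + J2 a vac) + J2 a (J1 a vac + J2 a vac))).

Definition kappa (k : C) : C := - (2 / M%:R) * k.

Definition ffactr (x : C) (m : nat) : C := \prod_(i < m) (x - (i : nat)%:R).

Definition D_square (k1 k2 : C) : C :=
  - M%:R / (2 * (M%:R + 2 * k1) * (M%:R + 2 * k2)
            * (3 * M%:R + 2 * k1 + 2 * k2) * (M%:R ^+ 2 - 4)).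

Definition C_coef (D k1 k2 : C) : C :=
  - (M%:R ^+ 3 / 4)
  * (D / ((k1 + M%:R) * (k2 + M%:R) * (k1 + k2 + M%:R))).

Definition W_state (D k1 k2 : C) : V :=
  let x := kappa k1 in
  let y := kappa k2 in
  C_coef D k1 k2 *: \sum_(a < n) \sum_(b < n) \sum_(c < n)
    sl_t (tnth I a) (tnth I b) (tnth I c) *:
    ((3^-1 * y * (y - 1) * (y - 2)) *: J1 a (J1 b (J1 c vac))
     - ((x - 2) * (y - 1) * (y - 2)) *: J1 a (J1 b (J2 c vac))
     + ((x - 1) * (x - 2) * (y - 2)) *: J1 a (J2 b (J2 c vac))
     - (3^-1 * x * (x - 1) * (x - 2)) *: J2 a (J2 b (J2 c vac))).

End States.

Section Contours.
Variable R : realType.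
Local Notation C := R[i].
Local Notation unitI := (`[0, 1]%classic : set R).

Definition cexp (z : C) : C :=
  (expR (complex.Re z) * cos (complex.Im z))
  +i* (expR (complex.Re z) * sin (complex.Im z)).

Definition Ccontinuous_on (T : topologicalType) (A : set T) (f : T -> C) :
    Prop :=
  {within A, continuous (fun x => complex.Re (f x))} /\
  {within A, continuous (fun x => complex.Im (f x))}.

Definition Cderive (f : R -> C) (t : R) : C :=
  derive1 (fun x => complex.Re (f x)) t +i*
  derive1 (fun x => complex.Im (f x)) t.

Definition C1 (f : R -> C) : Prop :=
  (forall t, derivable (fun x => complex.Re (f x)) t 1 /\
             derivable (fun x => complex.Im (f x)) t 1) /\
  Ccontinuous_on setT (Cderive f).

(* On each piece [u, v] of a finite subdivision of [0, 1], the curve is the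
   restriction of a C^1 map on the whole line (equivalently, it is C^1 up to
   the end points of the piece). *)
Definition piecewise_C1 (g : R -> C) : Prop :=
  exists s : seq R,
    [/\ path <%R 0 s, last 0 s = 1 &
        forall j, (j < size s)%N ->
          exists2 h : R -> C, C1 h &
            forall t, nth 0 (0 :: s) j <= t <= nth 0 s j -> g t = h t].

(* Curves are parametrized by [0, 1]; their values outside it are irrelevant. *)
Definition loop_avoiding01 (g : R -> C) : Prop :=
  [/\ Ccontinuous_on unitI g, g 0 = g 1 &
      forall t : R, 0 <= t <= 1 -> g t != 0 /\ g t != 1].

(* Free homotopy through closed curves: the base point may move. *)
Definition loop_homotopic (g0 g1 : R -> C) : Prop :=
  exists H : R * R -> C,
    [/\ Ccontinuous_on (unitI `*` unitI) H,
        forall s : R, 0 <= s <= 1 -> loop_avoiding01 (fun t => H (s, t)),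
        forall t : R, 0 <= t <= 1 -> H (0, t) = g0 t &
        forall t : R, 0 <= t <= 1 -> H (1, t) = g1 t].

(* With base point 1/2: once around 0 counterclockwise, once around 1
   counterclockwise, then the same two circles, in this order, clockwise. *)
Definition standard_pochhammer (t : R) : C :=
  let u (s : R) : C := 2^-1 * cexp (0 +i* (8 * pi * s)) in
  if t <= 4^-1 then u t
  else if t <= 2^-1 then 1 - u t
  else if t <= 3 / 4 then u (- t)
  else 1 - u (- t).

(* Both orientations are allowed: the choice of the order and of the sense of
   the two circles in the commutator only affects the orientation. *)
Definition pochhammer_contour (g : R -> C) : Prop :=
  [/\ piecewise_C1 g, loop_avoiding01 g &
      loop_homotopic g standard_pochhammer \/
      loop_homotopic g (fun t => standard_pochhammer (1 - t))].

(* [l] is a continuous determination of log f along [0, 1]. *)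
Definition log_along (f l : R -> C) : Prop :=
  Ccontinuous_on unitI l /\
  forall t : R, 0 <= t <= 1 -> cexp (l t) = f t.

(* The values along a curve of the branch of P(z)^s = z^(s k1) (z-1)^(s k2)
   given by the determinations l0 of log z and l1 of log (z - 1). *)
Definition Ppow (k1 k2 : C) (l0 l1 : R -> C) (s : C) (t : R) : C :=
  cexp (s * (k1 * l0 t + k2 * l1 t)).

(* \int_g f dz, where [f t] is the value of the integrand at the point g t. *)
Definition contour_integral (g f : R -> C) : C :=
  let F t := f t * Cderive g t in
  (\int[lebesgue_measure]_(t in unitI) complex.Re (F t))
  +i* (\int[lebesgue_measure]_(t in unitI) complex.Im (F t)).

(* Vector-valued contour integrals are defined weakly, by testing against all
   linear forms; as linear forms separate points, [v] is unique. *)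
Definition is_contour_integral (V : lmodType C) (g : R -> C) (f : R -> V)
    (v : V) : Prop :=
  forall phi : {scalar V}, phi v = contour_integral g (fun t => phi (f t)).

Definition vcontour_integral (V : lmodType C) (g : R -> C) (f : R -> V) : V :=
  xget 0 [set v | is_contour_integral g f v].

End Contours.

(* Main.v *)
Require Import Defs.
From HB Require Import structures.
From mathcomp Require Import all_boot all_order all_algebra.
From mathcomp Require Import complex.
From mathcomp Require Import all_classical all_reals all_analysis.
From mathcomp Require Import measurable_realfun.
From mathcomp Require Import ring lra.

Import Order.TTheory GRing.Theory Num.Theory.
Import numFieldNormedType.Exports.
Import complex.

Local Open Scope classical_set_scope.
Local Open Scope complex_scope.
Local Open Scope ring_scope.

(** Write J(a, b) for the integral of z^a (z - 1)^b along the contour, for the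
    branch given by the logarithms l0 of z and l1 of z - 1.  Expanding the
    fields A(z) and using that modes at different points commute and that
    t_abc is symmetric, varsigma_1(z) and varsigma_2(z) become combinations of
    the vectors [quad i j] and [cubic i j k], with coefficients
    z^-p (z - 1)^-q, p + q = 2 or 3 ([varsigma1E], [varsigma2E]).  As linear
    forms separate points ([linear_form_separates]), the weak contour
    integrals are the same combinations with coefficients J(a - p, b - q)
    ([vcontour_integral_comb]), and everything rests on Euler's relation
      (a)_p (b)_q J(a - p, b - q) = (-1)^q (a + b + 1)_(p + q) J(a, b),
    which is [euler_integral_ratio].

    This relation follows from z - (z - 1) = 1 and from the vanishing of the
    integral of d(z^a (z - 1)^b).  The latter holds because z^a (z - 1)^b
    takes the same value at both ends of the contour: l0 and l1 return to their
    initial values, i.e. a Pochhammer contour has winding number 0 around 0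
    and around 1 ([pochhammer_log_closed]).  Indeed this property is invariant
    under homotopy ([zero_winding_homotopy]), and on the standard Pochhammer
    contour, a commutator, the increment of the argument along each circle
    is cancelled by the one along the same circle run backwards
    ([zero_winding_commutator]).  The logarithms are only assumed to be
    continuous; their derivatives are computed in [cderiv_log], and the
    fundamental theorem of calculus is applied on each C^1 piece
    ([piecewise_integral]).

    When the right-hand side of Euler's relation is nonzero, so are the
    falling factorials on the left; hence special values of k1 and k2, such
    as 0, need not be discussed separately. *)

Set Implicit Arguments.
Unset Strict Implicit.

(** * Linear forms separate points *)

Lemma linear_form_separates (F : fieldType) (V : lmodType F) (v : V) :
  v != 0 -> exists phi : {scalar V}, phi v != 0.
Proof.
move=> v0.
(* Take a subspace maximal among those not containing v: it is a hyperplane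
   supplementary to the line of v.  The empty set is admitted, so that the
   union of an empty chain qualifies. *)
pose P (U : set V) := (forall c x y, U x -> U y -> U (c *: x + y)) /\ ~ U v.
have [|U [[Ulin Uv] Umax]] := @Zorn_bigcup V P.
  move=> S SP Stot; split=> [c x y [X SX Xx] [Y SY Yy]|[X SX Xv]]; last first.
    by have [_] := SP _ SX.
  have [XY|YX] := Stot _ _ SX SY.
    by exists Y => //; apply: (SP _ SY).1 => //; apply: XY.
  by exists X => //; apply: (SP _ SX).1 => //; apply: YX.
have U0 : U 0.
  apply: contrapT => nU0.
  have Unil x : ~ U x.
    by move=> Ux; apply: nU0; rewrite -(subrr x) addrC -scaleN1r; apply: Ulin.
  apply: (Umax [set 0]).
    by split=> [x /Unil//|/(_ 0 erefl)/Unil].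
  split=> [c x y -> ->|/esym/eqP]; first by rewrite scaler0 addr0.
  by rewrite eq_sym (negbTE v0).
have UZ c x : U x -> U (c *: x).
  by move=> Ux; rewrite -[_ *: _]addr0; apply: Ulin.
have dec x : exists c, U (x - c *: v).
  apply: contrapT => nex.
  pose U' : set V := [set y | exists c, exists2 u, U u & y = c *: x + u].
  apply: (Umax U').
    split=> [y Uy|/(_ x)Ux]; first by exists 0, y => //; rewrite scale0r add0r.
    apply: nex; exists 0; rewrite scale0r subr0; apply: Ux.
    by exists 1, 0 => //; rewrite scale1r addr0.
  split=> [c _ _ [a [u Uu ->]] [b [w Uw ->]]|[c [u Uu vE]]].
    exists (c * a + b), (c *: u + w); first exact: Ulin.
    by rewrite scalerDr scalerA scalerDl addrACA.
  apply: nex; have [c0|c0] := eqVneq c 0.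
    by move: Uu Uv; rewrite vE c0 scale0r add0r.
  exists c^-1; rewrite vE scalerDr scalerA mulVf// scale1r opprD addNKr.
  by rewrite -scaleN1r scalerA; apply: UZ.
(* The form is the coordinate along v modulo U. *)
have uniqc c x : U (x - c *: v) -> forall d, U (x - d *: v) -> c = d.
  move=> Uc d Ud; apply/eqP; rewrite -subr_eq0; apply/negPn/negP => cd.
  have := Ulin (-1) _ _ Uc Ud; rewrite scaleN1r opprB addrA subrK -scalerBl.
  by move=> /(UZ (c - d)^-1); rewrite scalerA mulVf// scale1r.
pose phi0 x : F^o := sval (cid (dec x)).
have phi0P x : U (x - phi0 x *: v) by rewrite /phi0; case: cid.
have phi0L : scalar phi0.
  move=> a x y; apply: uniqc (phi0P _) _ _.
  rewrite scalerDl opprD addrACA -scalerA -scalerBr.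
  exact: Ulin.
pose L := GRing.isLinear.Build _ _ _ _ phi0 phi0L.
pose phi : {scalar V} := HB.pack phi0 L.
exists phi; rewrite (_ : phi v = 1) ?oner_eq0//.
by apply: uniqc (phi0P v) _ _; rewrite scale1r subrr.
Qed.

(** * Quadratic and cubic invariants *)

Section Invariants.
Variables (R : realType) (M : nat) (V : affine_module R M) (vac : V).
Variables (n : nat) (I : n.-tuple (sl R M)).
Local Notation C := R[i].
Local Notation J i a := (@mode _ _ V (i : 'I_2) (-1) (tnth I a)).
Local Notation t a b c := (sl_t (tnth I a) (tnth I b) (tnth I c)).

(** The Casimir-type vectors sum_a I^a(i)_-1 I_a(j)_-1 |0>. *)
Definition quad (i j : 'I_2) : V := \sum_(a < n) J i a (J j a vac).

(** The vectors t_abc I^a(i)_-1 I^b(j)_-1 I^c(k)_-1 |0>. *)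
Definition cubic (i j k : 'I_2) : V :=
  \sum_(a < n) \sum_(b < n) \sum_(c < n) t a b c *: J i a (J j b (J k c vac)).

Lemma mode_comm (i j : 'I_2) a b v : i != j ->
  J i a (J j b v) = J j b (J i a v).
Proof.
move=> ij; apply/eqP; rewrite -subr_eq0; apply/eqP.
by have := @mode_mode _ _ V i j (-1) (-1) (tnth I a) (tnth I b) v;
  rewrite (negbTE ij).
Qed.

Lemma modezE (z : C) a v : modez z (-1) (tnth I a) v =
  z^-1 *: J ord0 a v + (z - 1)^-1 *: J ord_max a v.
Proof.
rewrite /modez big_ord_recl big_ord1 /marked_point subr0.
by rewrite (_ : lift ord0 ord0 = ord_max)//; apply: val_inj.
Qed.

Lemma varsigma1E (z : C) : varsigma1 vac I z =
  2^-1 *: (z^-1 ^+ 2 *: quad ord0 ord0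
    + (2 * z^-1 * (z - 1)^-1) *: quad ord0 ord_max
    + (z - 1)^-1 ^+ 2 *: quad ord_max ord_max).
Proof.
rewrite /varsigma1; congr (_ *: _).
transitivity (\sum_(a < n) (z^-1 ^+ 2 *: J ord0 a (J ord0 a vac)
    + (2 * z^-1 * (z - 1)^-1) *: J ord0 a (J ord_max a vac)
    + (z - 1)^-1 ^+ 2 *: J ord_max a (J ord_max a vac))); last first.
  by rewrite !big_split /= -!scaler_sumr.
apply: eq_bigr => a _; rewrite !modezE !linearD !linearZ /= !scalerA.
rewrite [J ord_max a (J ord0 a _)]mode_comm//.
rewrite !addrA -expr2; congr (_ + _); rewrite -!addrA; congr (_ + _).
by rewrite -scalerDl; congr (_ *: _); ring.
Qed.

Lemma omega_stateE (k1 k2 : C) : omega_state vac I k1 k2 =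
  ((2 * (k1 + M%:R))^-1 - (2 * (k1 + k2 + M%:R))^-1) *: quad ord0 ord0
  + ((2 * (k2 + M%:R))^-1 - (2 * (k1 + k2 + M%:R))^-1) *: quad ord_max ord_max
  - (2 * (2 * (k1 + k2 + M%:R))^-1) *: quad ord0 ord_max.
Proof.
rewrite /omega_state /quad !scaler_sumr -sumrN -!big_split /=.
apply: eq_bigr => a _.
rewrite !linearD /= [J ord_max a (J ord0 a _)]mode_comm//.
move: (J ord0 a _) (J ord_max a (J _ _ _)) (J ord0 a (J _ _ _)) => x y w.
set p := (2 * (k1 + M%:R))^-1; set q := (2 * (k2 + M%:R))^-1.
set s := (2 * (k1 + k2 + M%:R))^-1.
rewrite !scalerBl mulr_natl mulr2n scalerDl opprD (addrACA (p *: w)) -!addrA.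
congr (_ + (_ + _)); rewrite addrCA; congr (_ + _).
by rewrite [RHS]addrC -addrA.
Qed.

Lemma sl_t_swap12 (x y w : sl R M) : sl_t y x w = sl_t x y w.
Proof. by rewrite /sl_t addrC. Qed.

Lemma sl_t_swap23 (x y w : sl R M) : sl_t x w y = sl_t x y w.
Proof.
rewrite /sl_t !mxtraceD [LHS]addrC.
rewrite -[vsval w *m _ *m _]mulmxA [\tr (vsval w *m _)]mxtrace_mulC.
by rewrite [\tr (_ *m vsval w *m vsval y)]mxtrace_mulC mulmxA.
Qed.

Lemma cubicC12 i j k : i != j -> cubic i j k = cubic j i k.
Proof.
move=> ij; rewrite /cubic exchange_big /=.
apply: eq_bigr => a _; apply: eq_bigr => b _; apply: eq_bigr => c _.
by rewrite sl_t_swap12 mode_comm.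
Qed.

Lemma cubicC23 i j k : j != k -> cubic i j k = cubic i k j.
Proof.
move=> jk; rewrite /cubic; apply: eq_bigr => a _; rewrite exchange_big /=.
apply: eq_bigr => b _; apply: eq_bigr => c _.
by rewrite sl_t_swap23 [J j _ (J k _ _)]mode_comm.
Qed.

Lemma varsigma2E (z : C) : varsigma2 vac I z =
  3^-1 *: (z^-1 ^+ 3 *: cubic ord0 ord0 ord0
    + (3 * z^-1 ^+ 2 * (z - 1)^-1) *: cubic ord0 ord0 ord_max
    + (3 * z^-1 * (z - 1)^-1 ^+ 2) *: cubic ord0 ord_max ord_max
    + (z - 1)^-1 ^+ 3 *: cubic ord_max ord_max ord_max).
Proof.
rewrite /varsigma2; congr (_ *: _).
set p := z^-1; set q := (z - 1)^-1.
transitivity (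
    p * p * p *: cubic ord0 ord0 ord0 + p * p * q *: cubic ord0 ord0 ord_max
    + (p * q * p *: cubic ord0 ord_max ord0
       + p * q * q *: cubic ord0 ord_max ord_max)
    + (q * p * p *: cubic ord_max ord0 ord0
       + q * p * q *: cubic ord_max ord0 ord_max
       + (q * q * p *: cubic ord_max ord_max ord0
          + q * q * q *: cubic ord_max ord_max ord_max))).
  rewrite /cubic !scaler_sumr -!big_split /=; apply: eq_bigr => a _.
  rewrite !scaler_sumr -!big_split /=; apply: eq_bigr => b _.
  rewrite !scaler_sumr -!big_split /=; apply: eq_bigr => c _.
  have JP i d (r s : C) x y :
      J i d (r *: x + s *: y) = r *: J i d x + s *: J i d y.
    by rewrite linearD !linearZ.
  rewrite !modezE -/p -/q !JP.
  move: (t a b c) (J ord0 a _) (J ord0 a _) (J ord0 a _) (J ord0 a _)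
    (J ord_max a _) (J ord_max a _) (J ord_max a _) (J ord_max a _).
  move=> s x1 x2 x3 x4 x5 x6 x7 x8; rewrite !scalerDr !scalerA.
  by congr ((_ *: _ + _ *: _ + (_ *: _ + _ *: _))
    + (_ *: _ + _ *: _ + (_ *: _ + _ *: _))); ring.
rewrite [cubic ord_max ord0 ord_max]cubicC12//.
rewrite [cubic ord_max ord_max ord0]cubicC23//.
rewrite [cubic ord_max ord0 ord_max]cubicC12//.
rewrite [cubic ord_max ord0 ord0]cubicC12//.
rewrite [cubic ord0 ord_max ord0]cubicC23//.
move: (cubic _ _ _) (cubic _ _ _) (cubic _ _ _) (cubic _ _ _) => x y u w.
rewrite !addrA [LHS](ACl (1*(2*3*5)*(4*6*7)*8))%AC /=.
rewrite -!(scalerDl u) -!(scalerDl y).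
by congr (_ *: _ + _ *: _ + _ *: _ + _ *: _); ring.
Qed.
End Invariants.

Lemma W_stateE (R : realType) (M : nat) (V : affine_module R M) (vac : V)
    (n : nat) (I : n.-tuple (sl R M)) (D k1 k2 : R[i]) :
  let x := kappa M k1 in let y := kappa M k2 in
  W_state vac I D k1 k2 = C_coef M D k1 k2 *:
    ((3^-1 * y * (y - 1) * (y - 2)) *: cubic vac I ord0 ord0 ord0
     - ((x - 2) * (y - 1) * (y - 2)) *: cubic vac I ord0 ord0 ord_max
     + ((x - 1) * (x - 2) * (y - 2)) *: cubic vac I ord0 ord_max ord_max
     - (3^-1 * x * (x - 1) * (x - 2)) *: cubic vac I ord_max ord_max ord_max).
Proof.
rewrite /= /W_state /cubic; congr (_ *: _).
rewrite !scaler_sumr -!sumrN -!big_split /=; apply: eq_bigr => a _.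
rewrite !scaler_sumr -!sumrN -!big_split /=; apply: eq_bigr => b _.
rewrite !scaler_sumr -!sumrN -!big_split /=; apply: eq_bigr => c _.
move: (sl_t _ _ _) => t; rewrite !scalerDr !scalerN !scalerA.
by rewrite ![t * _]mulrC.
Qed.

(** * Winding numbers *)

Section Winding.
Variable R : realType.
Local Notation C := R[i].
Implicit Types (x y th : R -> R) (g : R -> C).

Lemma within_comp (T S U : topologicalType) (A : set S) (f : S -> U)
    (c : T -> S) :
  {within A, continuous f} -> continuous c -> (forall t, A (c t)) ->
  continuous (f \o c).
Proof.
move=> /subspace_continuousP fA cc cA t B /(fA _ (cA t)) fB.
have h : nbhs t (fun s => A (c s) -> B (f (c s))) := cc t _ fB.
rewrite nbhs_filterE; change (nbhs t (fun s => B (f (c s)))).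
by apply: filterS h => s; apply; exact: cA.
Qed.

Lemma continuous_pair (T S U : topologicalType) (f : T -> S) (h : T -> U) :
  continuous f -> continuous h -> continuous (fun t => (f t, h t)).
Proof. by move=> cf ch t; exact: (cvg_pair (cf t) (ch t)). Qed.

(** The retraction of the line onto [0, 1]: composing with it turns functions
    continuous on [0, 1] into functions continuous everywhere. *)
Definition clamp (t : R) : R := Num.max 0 (Num.min 1 t).

Lemma clamp01 t : 0 <= clamp t <= 1.
Proof. by rewrite /clamp le_max lexx ge_max ler01 ge_min lexx. Qed.

Lemma clamp_id t : 0 <= t <= 1 -> clamp t = t.
Proof. by move=> /andP[t0 t1]; rewrite /clamp (min_idPr t1) (max_idPr t0). Qed.

Lemma continuous_clamp : continuous clamp.
Proof.
move=> t.
have c1 : {for t, continuous (fun t : R => Num.min 1 t : R^o)}.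
  by apply: continuous_min; [exact: cvg_cst | exact: cvg_id].
exact: (continuous_max (@cvg_cst _ _ _ _ _) c1).
Qed.

(** Connectedness of [0, 1]. *)
Lemma locally_constant (P : R -> Prop) :
  (forall s, \forall s' \near s, P s <-> P s') -> P 0 -> P 1.
Proof.
move=> Pn P0.
have oP (Q : R -> Prop) : (forall s, \forall s' \near s, Q s <-> Q s') ->
    open [set s | Q s].
  move=> Qn; rewrite openE => s /= Qs; rewrite /interior /=.
  by apply: filterS (Qn s) => s' [+ _]; apply.
have := @segment_connected R 0 1 (`[0, 1] `&` [set s | P s]).
have H01 : `[0%R, 1%R]%classic (1 : R) by rewrite /= in_itv /= ler01 lexx.
move=> H; suff : (`[0, 1] `&` [set s | P s]) (1 : R) by case.
rewrite H//.
- by exists 0; split => //=; rewrite in_itv /= ler01 lexx.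
- by exists [set s | P s]; first exact: oP.
- exists [set s | P s] => //; rewrite -[X in closed X]setCK; apply: open_closedC.
  apply: (oP (fun s => ~ P s)) => s.
  by apply: filterS (Pn s) => s' [h1 h2]; split; auto.
Qed.

(** [th] is a continuous determination of the argument along the curve with
    coordinates x and y, which is then nowhere 0. *)
Definition angle_along x y th := continuous th /\
  forall t, exists2 r : R, 0 < r & x t = r * cos (th t) /\ y t = r * sin (th t).

Lemma angle_increment x y th th' :
  angle_along x y th -> angle_along x y th' -> th 1 - th 0 = th' 1 - th' 0.
Proof.
move=> [cth Hth] [cth' Hth'].
pose d t := th t - th' t.
have cd : continuous d by move=> t; apply: cvgB; [exact: cth | exact: cth'].
have sd t : sin (d t) = 0.
  have [r r0 [xE yE]] := Hth t; have [r' r'0 [xE' yE']] := Hth' t.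
  have /eqP : r * r' * sin (d t) = 0.
    rewrite /d sinB.
    transitivity ((r * sin (th t)) * (r' * cos (th' t))
      - (r * cos (th t)) * (r' * sin (th' t))); first by ring.
    by rewrite -xE -yE -xE' -yE'; ring.
  by rewrite mulf_eq0 gt_eqF ?mulr_gt0//= => /eqP.
have cd0 t : cos (d t) != 0.
  apply/eqP => c0; have := cos2Dsin2 (d t); rewrite c0 sd => /eqP.
  by rewrite expr0n /= addr0 eq_sym oner_eq0.
(* d takes its values in the discrete set of the multiples of pi. *)
suff : d 1 = d 0 by rewrite /d; lra.
apply: (@locally_constant (fun t => d t = d 0)) => // t.
have nd : \forall s \near t, `|d t - d s| < 1.
  by exact: cvgr_dist_lt (cd t) _ ltr01.
apply: filterS nd => s ds.
suff -> : d t = d s by [].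
have s0 : sin (d t - d s) = 0 by rewrite sinB !sd mul0r mulr0 subr0.
have pi2 := pi_ge2 R.
apply/eqP; rewrite -subr_eq0; apply/eqP.
move: ds s0; set e := d t - d s => el s0.
have [e0|e0|//] := ltgtP e 0.
  suff : 0 < sin (- e) by rewrite sinN s0 oppr0 ltxx.
  by apply: sin_gt0_pi; move: el; rewrite ltr0_norm//; lra.
suff : 0 < sin e by rewrite s0 ltxx.
by apply: sin_gt0_pi; move: el; rewrite gtr0_norm//; lra.
Qed.

(** If x' + i y' stays at an angle less than pi / 2 of x + i y, the angle
    between them is an arctangent, which returns to its initial value when
    both curves are closed; so the two arguments have the same increment. *)
Lemma angle_transfer x y x' y' th :
  continuous x -> continuous y -> continuous x' -> continuous y' ->
  (forall t, 0 < x' t * x t + y' t * y t) ->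
  x 0 = x 1 -> y 0 = y 1 -> x' 0 = x' 1 -> y' 0 = y' 1 ->
  angle_along x y th ->
  exists2 th', angle_along x' y' th' & th' 1 - th' 0 = th 1 - th 0.
Proof.
move=> cx cy cx' cy' pos x01 y01 x01' y01' [cth Hth].
pose a t := x' t * x t + y' t * y t; pose b t := y' t * x t - x' t * y t.
pose phi t := atan (b t / a t).
exists (fun t => th t + phi t); last first.
  by rewrite /phi /a /b x01 y01 x01' y01'; ring.
have ca : continuous a.
  by move=> t; apply: cvgD; apply: cvgM;
    [exact: cx' | exact: cx | exact: cy' | exact: cy].
have cb : continuous b.
  by move=> t; apply: cvgB; apply: cvgM;
    [exact: cy' | exact: cx | exact: cx' | exact: cy].
split.
  move=> t; apply: cvgD; first exact: cth.
  apply: continuous_comp; last exact: continuous_atan.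
  apply: cvgM; first exact: cb.
  by apply: cvgV; [rewrite gt_eqF//; exact: pos | exact: ca].
move=> t; have [r r0 [xE yE]] := Hth t.
have cphi : 0 < cos (phi t).
  by apply: cos_gt0_pihalf; rewrite atan_gtNpi2 atan_ltpi2.
have at0 : 0 < a t := pos t.
have tphi : sin (phi t) * a t = cos (phi t) * b t.
  have : tan (phi t) = b t / a t by rewrite /phi atanK.
  rewrite /tan => /eqP.
  rewrite eqr_div ?(gt_eqF cphi) ?(gt_eqF at0)// => /eqP ->.
  by rewrite mulrC.
exists (a t / (r * cos (phi t))).
  by rewrite divr_gt0// mulr_gt0.
have cs := cos2Dsin2 (th t).
rewrite cosD sinD.
have E1 : x' t * r = a t * cos (th t) - b t * sin (th t).
  rewrite /a /b xE yE -[LHS]mulr1 -cs; ring.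
have E2 : y' t * r = a t * sin (th t) + b t * cos (th t).
  rewrite /a /b xE yE -[LHS]mulr1 -cs; ring.
have rn0 : r != 0 by rewrite gt_eqF.
have cn0 : cos (phi t) != 0 by rewrite gt_eqF.
split; apply: (mulIf rn0); apply: (mulIf cn0).
  rewrite E1; transitivity
    (a t * cos (th t) * cos (phi t) - sin (th t) * (cos (phi t) * b t)).
    by ring.
  by rewrite -tphi; field; rewrite rn0 cn0.
rewrite E2; transitivity
    (a t * sin (th t) * cos (phi t) + cos (th t) * (cos (phi t) * b t)).
  by ring.
by rewrite -tphi; field; rewrite rn0 cn0.
Qed.

(** The argument returns to its initial value along the curve; this is vacuously
    true of a curve without a continuous argument. *)
Definition zero_winding x y := forall th, angle_along x y th -> th 1 = th 0.

Lemma zero_winding_transfer x y x' y' :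
  continuous x -> continuous y -> continuous x' -> continuous y' ->
  (forall t, 0 < x' t * x t + y' t * y t) ->
  x 0 = x 1 -> y 0 = y 1 -> x' 0 = x' 1 -> y' 0 = y' 1 ->
  zero_winding x' y' -> zero_winding x y.
Proof.
move=> cx cy cx' cy' pos x01 y01 x01' y01' Z th Hth.
have [th' /Z E] := angle_transfer cx cy cx' cy' pos x01 y01 x01' y01' Hth.
by rewrite E subrr => /esym/eqP; rewrite subr_eq0 => /eqP.
Qed.

Lemma zero_winding_homotopy (X Y : R * R -> R) :
  continuous X -> continuous Y ->
  (forall s t, 0 < X (s, t) ^+ 2 + Y (s, t) ^+ 2) ->
  (forall s, X (s, 0) = X (s, 1) /\ Y (s, 0) = Y (s, 1)) ->
  (forall s t, X (s, clamp t) = X (s, t) /\ Y (s, clamp t) = Y (s, t)) ->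
  zero_winding (fun t => X (1, t)) (fun t => Y (1, t)) ->
  zero_winding (fun t => X (0, t)) (fun t => Y (0, t)).
Proof.
move=> cX cY pos loop XYclamp.
have cpair (Z : R * R -> R) s : continuous Z -> continuous (fun t => Z (s, t)).
  move=> cZ t; apply: (@continuous_comp _ _ _ (fun t : R => (s, t)) Z);
    last exact: cZ.
  by apply: (continuous_pair (f := fun=> s) (h := id)) => ?;
    [exact: cvg_cst | exact: cvg_id].
pose P s := zero_winding (fun t => X (s, t)) (fun t => Y (s, t)).
suff H : forall s, \forall s' \near s, P s <-> P s'.
  apply: contraPP => /= nP0 P1.
  apply: (@locally_constant (fun s => ~ P s) _ nP0 P1) => s.
  have Hs := H s.
  by apply: filterS Hs => s' [h1 h2]; split; auto.
move=> s0.
(* By compactness of [0, 1], the whole curve at time s is at an angle less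
   than pi / 2 of the curve at time s0 as soon as s is close to s0. *)
pose Q s t : Prop := 0 < X (s, t) * X (s0, t) + Y (s, t) * Y (s0, t).
have Qpos : \forall s \near s0, `[0%R, 1%R]%classic `<=` Q s.
  have nc := iffLR (compact_near_coveringP _) (@segment_compact R 0 1).
  apply: (nc R (nbhs s0) Q _) => t _.
  pose W (p : R * R) := X (p.2, p.1) * X (s0, p.1) + Y (p.2, p.1) * Y (s0, p.1).
  have cW : continuous W.
    have swapC (Z : R * R -> R) (f : R * R -> R) : 
        continuous Z -> continuous f ->
        continuous (fun p : R * R => Z (f p, p.1)).
      move=> cZ cf p; apply: (@continuous_comp _ _ _ (fun p : R * R => (f p, p.1)) Z);
        last exact: cZ.
      by apply: continuous_pair => // q; exact: cvg_fst.
    move=> p; apply: cvgD; apply: cvgM.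
    - by apply: (swapC X snd) => // q; exact: cvg_snd.
    - by apply: (swapC X (fun=> s0)) => // q; exact: cvg_cst.
    - by apply: (swapC Y snd) => // q; exact: cvg_snd.
    - by apply: (swapC Y (fun=> s0)) => // q; exact: cvg_cst.
  have : \forall p \near (t, s0), 0 < W p.
    by apply: (cvgr_gt (W (t, s0)) (cW (t, s0)));
      rewrite /W /= -!expr2; exact: pos.
  by [].
apply: filterS Qpos => s Qs.
have Qall t : Q s t.
  have [X1 Y1] := XYclamp s t; have [X2 Y2] := XYclamp s0 t.
  by rewrite /Q -X1 -X2 -Y1 -Y2; apply: Qs;
    rewrite /= in_itv /=; exact: clamp01.
have [ls1 ls2] := loop s; have [l01 l02] := loop s0.
split; apply: zero_winding_transfer; rewrite //=; try exact: cpair.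
move=> t; have := Qall t; rewrite /Q; lra.
Qed.

(** The third quarter of the curve is the first one run backwards, and the
    fourth is the second one run backwards. *)
Lemma zero_winding_commutator x y :
  (forall s, 0 <= s <= 4^-1 -> x (3 / 4 - s) = x s /\ y (3 / 4 - s) = y s) ->
  (forall s, 4^-1 <= s <= 2^-1 -> x (5 / 4 - s) = x s /\ y (5 / 4 - s) = y s) ->
  zero_winding x y.
Proof.
move=> H1 H2 th [cth Hth].
have key (f h : R -> R) : continuous f -> continuous h ->
    (forall s, 0 <= s <= 1 -> x (f s) = x (h s) /\ y (f s) = y (h s)) ->
    th (f 1) - th (f 0) = th (h 1) - th (h 0).
  move=> cf ch fh.
  have cl (u : R -> R) : continuous u ->
      angle_along (x \o (u \o clamp)) (y \o (u \o clamp)) (th \o (u \o clamp)).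
    move=> cu; split=> [t|t]; last exact: Hth.
    apply: continuous_comp; last exact: cth.
    by apply: continuous_comp; [exact: continuous_clamp | exact: cu].
  have := cl _ cf.
  rewrite (_ : x \o (f \o clamp) = x \o (h \o clamp)); last first.
    by apply/funext => t /=; have [->] := fh _ (clamp01 t).
  rewrite (_ : y \o (f \o clamp) = y \o (h \o clamp)); last first.
    by apply/funext => t /=; have [_ ->] := fh _ (clamp01 t).
  move=> Af; have := angle_increment Af (cl _ ch).
  by rewrite /= !clamp_id ?lexx ?ler01.
have cD (f h : R -> R) : continuous f -> continuous h ->
    continuous (fun s => f s + h s).
  by move=> cf ch s; apply: cvgD; [exact: cf | exact: ch].
have c0 (k : R) : continuous (fun _ : R => k) by move=> s; exact: cvg_cst.
have cl (k : R) : continuous (fun s : R => s * k).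
  by move=> s; apply: cvgM; [exact: cvg_id | exact: cvg_cst].
have := @key (fun s => 3 / 4 + s * - 4^-1) (fun s => s * 4^-1)
  (cD _ _ (c0 _) (cl _)) (cl _).
have := @key (fun s => 1 + s * - 4^-1) (fun s => 4^-1 + s * 4^-1)
  (cD _ _ (c0 _) (cl _)) (cD _ _ (c0 _) (cl _)).
rewrite /= !mul0r !mul1r !addr0.
have -> : 3 / 4 + - 4^-1 = 2^-1 :> R by lra.
have -> : 1 + - 4^-1 = 3 / 4 :> R by lra.
have -> : 4^-1 + 4^-1 = 2^-1 :> R by lra.
move=> K2 K1.
have {}K1 : th 2^-1 - th (3 / 4) = th 4^-1 - th 0.
  apply: K1 => s s01.
  rewrite (_ : 3 / 4 + s * - 4^-1 = 3 / 4 - s * 4^-1); last by ring.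
  by apply: H1; lra.
have {}K2 : th (3 / 4) - th 1 = th 2^-1 - th 4^-1.
  apply: K2 => s s01.
  rewrite (_ : 1 + s * - 4^-1 = 5 / 4 - (4^-1 + s * 4^-1)); last by field.
  by apply: H2; lra.
lra.
Qed.

(** * Logarithms along a Pochhammer contour *)

Lemma ReD (z w : C) : complex.Re (z + w) = complex.Re z + complex.Re w.
Proof. by case: z; case: w. Qed.
Lemma ImD (z w : C) : complex.Im (z + w) = complex.Im z + complex.Im w.
Proof. by case: z; case: w. Qed.
Lemma ReN (z : C) : complex.Re (- z) = - complex.Re z.
Proof. by case: z. Qed.
Lemma ImN (z : C) : complex.Im (- z) = - complex.Im z.
Proof. by case: z. Qed.
Lemma ReM (z w : C) : complex.Re (z * w) =
  complex.Re z * complex.Re w - complex.Im z * complex.Im w.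
Proof. by case: z; case: w. Qed.
Lemma ImM (z w : C) : complex.Im (z * w) =
  complex.Re z * complex.Im w + complex.Im z * complex.Re w.
Proof. by case: z; case: w. Qed.

Lemma complex_eq (z w : C) :
  complex.Re z = complex.Re w -> complex.Im z = complex.Im w -> z = w.
Proof. by case: z; case: w => /= a b c d -> ->. Qed.

Lemma normsq_gt0 (z : C) : z != 0 -> 0 < complex.Re z ^+ 2 + complex.Im z ^+ 2.
Proof.
move=> z0; rewrite lt_neqAle addr_ge0 ?sqr_ge0// andbT eq_sym.
apply: contra z0; rewrite paddr_eq0 ?sqr_ge0// !sqrf_eq0.
move=> /andP[/eqP a /eqP b].
by apply/eqP/complex_eq.
Qed.

Lemma log_along_closed g l : g 0 = g 1 -> log_along g l ->
  zero_winding (fun t => complex.Re (g (clamp t)))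
               (fun t => complex.Im (g (clamp t))) -> l 1 = l 0.
Proof.
move=> g01 [[cRe cIm] gE] Z.
have c1 : clamp 1 = 1 by rewrite clamp_id ?lexx ?ler01.
have c0 : clamp 0 = 0 by rewrite clamp_id ?lexx ?ler01.
(* The imaginary part of l is an argument of g, and its real part is determined
   by the modulus of g. *)
apply: complex_eq; last first.
  rewrite -{1}c1 -{1}c0; apply: (Z (fun t => complex.Im (l (clamp t)))).
  split.
    apply: (within_comp cIm); first exact: continuous_clamp.
    by move=> t; rewrite /= in_itv /=; exact: clamp01.
  move=> t; rewrite -(gE _ (clamp01 t)).
  by exists (expR (complex.Re (l (clamp t)))); first exact: expR_gt0.
have e1 : expR (complex.Re (l 1)) ^+ 2 = expR (complex.Re (l 0)) ^+ 2.
  have sq t : 0 <= t <= 1 -> expR (complex.Re (l t)) ^+ 2 =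
      complex.Re (g t) ^+ 2 + complex.Im (g t) ^+ 2.
    by move=> /gE <-; rewrite /= !exprMn -mulrDr cos2Dsin2 mulr1.
  by rewrite !sq ?lexx ?ler01// g01.
apply: expR_inj; apply/eqP; move/eqP: e1.
by rewrite eqrXn2// ?expR_ge0.
Qed.

Lemma zero_winding_loop_homotopic g0 g1 (p : C) : (p == 0) || (p == 1) ->
  loop_homotopic g0 g1 ->
  zero_winding (fun t => complex.Re (g1 (clamp t) - p))
               (fun t => complex.Im (g1 (clamp t) - p)) ->
  zero_winding (fun t => complex.Re (g0 (clamp t) - p))
               (fun t => complex.Im (g0 (clamp t) - p)).
Proof.
move=> p01 [H [[cRe cIm] Hloop H0 H1]].
pose cl2 (q : R * R) := (clamp q.1, clamp q.2).
have ccl2 : continuous cl2.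
  apply: continuous_pair => q.
    by apply: (@continuous_comp _ _ _ fst clamp);
      [exact: cvg_fst | exact: continuous_clamp].
  by apply: (@continuous_comp _ _ _ snd clamp);
    [exact: cvg_snd | exact: continuous_clamp].
have cl2in q : (`[0%R, 1%R] `*` `[0%R, 1%R])%classic (cl2 q).
  by split; rewrite /= in_itv /=; exact: clamp01.
pose X q := complex.Re (H (cl2 q) - p); pose Y q := complex.Im (H (cl2 q) - p).
have cX : continuous X.
  rewrite /X; under eq_fun do rewrite ReD.
  move=> q; apply: cvgD; last exact: cvg_cst.
  exact: (within_comp cRe ccl2 cl2in).
have cY : continuous Y.
  rewrite /Y; under eq_fun do rewrite ImD.
  move=> q; apply: cvgD; last exact: cvg_cst.
  exact: (within_comp cIm ccl2 cl2in).
have c1 : clamp 1 = 1 by rewrite clamp_id ?lexx ?ler01.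
have c0 : clamp 0 = 0 by rewrite clamp_id ?lexx ?ler01.
have := @zero_winding_homotopy X Y cX cY.
rewrite /X /Y /cl2 /= c0 c1 => h.
have h1 t := H1 _ (clamp01 t); have h0 t := H0 _ (clamp01 t).
move: h; under eq_fun do rewrite h1.
under [X in zero_winding _ X -> _]eq_fun do rewrite h1.
under [X in _ -> zero_winding X _]eq_fun do rewrite h0.
under [X in _ -> zero_winding _ X]eq_fun do rewrite h0.
apply.
- move=> s t; apply: normsq_gt0; rewrite subr_eq0.
  have [_ _ /(_ _ (clamp01 t)) [n0 n1]] := Hloop _ (clamp01 s).
  by case/orP: p01 => /eqP ->.
- move=> s; have [_ -> _] := Hloop _ (clamp01 s); by [].
- by move=> s t; rewrite (clamp_id (clamp01 t)).
Qed.

(** Each circle and its inverse are run at symmetric times.  At the common end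
    points of two circles both formulas give the base point 1/2. *)
Lemma standard_pochhammer_symmetric :
  (forall s : R, 0 <= s <= 4^-1 ->
     standard_pochhammer (3 / 4 - s) = standard_pochhammer s) /\
  (forall s : R, 4^-1 <= s <= 2^-1 ->
     standard_pochhammer (5 / 4 - s) = standard_pochhammer s).
Proof.
pose u (s : R) : C := 2^-1 * cexp (0 +i* (8 * pi * s)).
have uE (s : R) : standard_pochhammer s =
    if s <= 4^-1 then u s else if s <= 2^-1 then 1 - u s
    else if s <= 3 / 4 then u (- s) else 1 - u (- s) by [].
have uD s : u (s + 4^-1) = u s.
  rewrite /u; congr (_ * _).
  have -> : 8 * pi * (s + 4^-1) = 8 * pi * s + pi *+ 2 :> R by field.
  by rewrite /cexp /= cosD2pi sinD2pi.
have uDn s k : u (s + 4^-1 *+ k) = u s.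
  by elim: k => [|k IH]; rewrite ?addr0// mulrSr addrA uD.
have u0 : u 0 = 2^-1.
  by rewrite /u /cexp /= mulr0 expR0 cos0 sin0 mulr0 mulr1 mulr1.
have uB s k : u (s - 4^-1 *+ k) = u s by rewrite -[LHS](uDn _ k) subrK.
have u4 (s : R) : s \in [:: 4^-1; 2^-1; - 2^-1; - (3 / 4); -1] -> u s = 2^-1.
  rewrite !inE => /orP[/eqP->|/orP[/eqP->|/orP[/eqP->|/orP[]/eqP->]]];
    rewrite -u0.
  - by rewrite -(uDn 0 1%N); congr u; lra.
  - by rewrite -(uDn 0 2%N); congr u; lra.
  - by rewrite -(uB 0 2%N); congr u; lra.
  - by rewrite -(uB 0 3%N); congr u; lra.
  - by rewrite -(uB 0 4%N); congr u; lra.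
have half : 1 - 2^-1 = 2^-1 :> C by field.
split=> s s14; rewrite !uE.
  have -> : (s <= 4^-1) = true by lra.
  have -> : (3 / 4 - s <= 4^-1) = false by apply/negbTE; lra.
  case: ifPn => h1.
    have -> : s = 4^-1 by lra.
    have -> : 3 / 4 - 4^-1 = 2^-1 :> R by lra.
    by rewrite !u4 ?inE ?eqxx ?orbT.
  have -> : (3 / 4 - s <= 3 / 4) = true by lra.
  by rewrite -(uB s 3%N); congr u; lra.
have [->|s4] := eqVneq s 4^-1.
  have -> : 5 / 4 - 4^-1 = 1 :> R by lra.
  have -> : (1 <= 4^-1 :> R) = false by apply/negbTE; lra.
  have -> : (1 <= 2^-1 :> R) = false by apply/negbTE; lra.
  have -> : (1 <= 3 / 4 :> R) = false by apply/negbTE; lra.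
  rewrite lexx.
  by rewrite !u4 ?inE ?eqxx ?orbT.
have -> : (s <= 4^-1) = false.
  by apply/negbTE; move: s4 s14; rewrite neq_lt; lra.
have -> : (s <= 2^-1) = true by lra.
have -> : (5 / 4 - s <= 4^-1) = false by apply/negbTE; lra.
have -> : (5 / 4 - s <= 2^-1) = false by apply/negbTE; lra.
case: ifPn => h1.
  have -> : s = 2^-1 by lra.
  have -> : - (5 / 4 - 2^-1) = - (3 / 4) :> R by lra.
  by rewrite !u4 ?inE ?eqxx ?orbT.
by congr (1 - _); rewrite -(uB s 5%N); congr u; lra.
Qed.

Lemma pochhammer_log_closed g l (p : C) : (p == 0) || (p == 1) ->
  pochhammer_contour g -> log_along (fun t => g t - p) l -> l 1 = l 0.
Proof.
move=> p01 [_ [_ g01 _] gh] lg; have [S1 S2] := standard_pochhammer_symmetric.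
apply: (log_along_closed _ lg); first by rewrite g01.
have cl (s : R) : 0 <= s <= 1 -> clamp s = s by exact: clamp_id.
case: gh => /(zero_winding_loop_homotopic p01); apply;
  apply: zero_winding_commutator => s hs; rewrite !clamp_id; try lra.
- by rewrite S1.
- by rewrite S2.
- have -> : 1 - (3 / 4 - s) = 4^-1 + s by lra.
  have -> : 1 - s = 5 / 4 - (4^-1 + s) by lra.
  by rewrite S2//; lra.
- have -> : 1 - (5 / 4 - s) = s - 4^-1 by lra.
  have -> : 1 - s = 3 / 4 - (s - 4^-1) by lra.
  by rewrite S1//; lra.
Qed.

End Winding.

(** * Integrals of piecewise continuous functions *)

Section PiecewiseIntegrals.
Variable R : realType.
Local Notation mu := (@lebesgue_measure R).
Implicit Types (u v w : R) (f G : R -> R).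

(** A property of intervals that is stable under concatenation passes from the
    pieces of a subdivision to the whole interval. *)
Lemma subdivision_ind (Q : R -> R -> Prop) :
  (forall u v w, u < v -> v < w -> Q u v -> Q v w -> Q u w) ->
  forall (s : seq R) (a : R), path <%R a s -> s != [::] ->
  (forall j, (j < size s)%N -> Q (nth 0 (a :: s) j) (nth 0 s j)) ->
  a < last a s /\ Q a (last a s).
Proof.
move=> Qt; elim=> [//|v s IH] a /= /andP[av vs] _ H.
have Q0 : Q a v := H 0%N isT.
have [->|s0] := eqVneq s [::]; first by [].
have [|vl Ql] := IH v vs s0; first by move=> j js; exact: (H j.+1).
by split; [exact: lt_trans vl | exact: Qt Ql].
Qed.

Lemma segment_split u v w : u < v -> v < w ->
  `[u, w]%classic = `[u, v]%classic `|` `]v, w]%classic.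
Proof.
by move=> uv vw; rewrite -itv_bndbnd_setU// bnd_simp ltW.
Qed.

Lemma integrable_segment_cat f u v w : u < v -> v < w ->
  mu.-integrable `[u, v] (EFin \o f) -> mu.-integrable `[v, w] (EFin \o f) ->
  mu.-integrable `[u, w] (EFin \o f).
Proof.
move=> uv vw fuv fvw; rewrite (segment_split uv vw).
have {}fvw : mu.-integrable `]v, w] (EFin \o f).
  by apply: integrableS fvw => //; apply: subset_itvr; rewrite bnd_simp.
have mk D : measurable D -> mu.-integrable D (EFin \o f) <->
    mu.-integrable setT ((EFin \o f) \_ D) by exact: integrable_mkcond.
apply/mk; first exact: measurableU.
move: fuv fvw => /(mk _ (measurable_itv _)) fuv /(mk _ (measurable_itv _)) fvw.
have := integrableD measurableT fuv fvw.
apply: eq_integrable => // x _ /=; rewrite /patch in_setU.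
have [/set_mem xuv|_] := boolP (x \in `[u, v]%classic);
  have [/set_mem xvw|_] := boolP (x \in `]v, w]%classic);
  rewrite /= ?addr0 ?add0r //.
exfalso; move: xuv xvw; rewrite /= !in_itv /= => /andP[_ xv] /andP[].
by rewrite ltNge xv.
Qed.

(** A function that agrees inside [u, v] with a continuous one; its values at
    the end points are arbitrary. *)
Definition inner_continuous f u v := exists2 h : R -> R,
  {within `[u, v], continuous h} & forall t, u < t < v -> f t = h t.

Lemma continuous_measurable_oo f u v : {within `[u, v], continuous f} ->
  measurable_fun `]u, v[ f.
Proof.
move=> cf; apply: (@measurable_funS _ _ _ _ `[u, v]%classic) => //.
  by move=> t; rewrite /= !in_itv /= => /andP[/ltW -> /ltW ->].
exact: subspace_continuous_measurable_fun.
Qed.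

Lemma inner_continuous_measurable f u v : inner_continuous f u v ->
  measurable_fun `]u, v[ f.
Proof.
move=> [h ch fh]; apply: (eq_measurable_fun h).
  by move=> t; rewrite inE /= in_itv /= => /fh.
exact: continuous_measurable_oo.
Qed.

Lemma inner_continuous_integrable f u v : u < v -> inner_continuous f u v ->
  mu.-integrable `[u, v] (EFin \o f).
Proof.
move=> uv H; have mf := inner_continuous_measurable H.
have [h ch fh] := H.
have mf' : measurable_fun `[u, v] f.
  exact/measurable_fun_itv_obnd_cbndP/measurable_fun_itv_bndo_bndcP.
have muv : mu [set u; v] = 0%E.
  apply: countable_lebesgue_measure0; exact/finite_set_countable/finite_set2.
have m2 : measurable [set u; v].
  exact: (measurableU _ _ (measurable_set1 u) (measurable_set1 v)).
have mD : measurable (`[u, v]%classic `\` [set u; v]) by exact: measurableD.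
apply: (iffRL (negligible_integrable _ _ _ muv)) => //.
- exact/measurable_EFinP.

have ih : mu.-integrable `[u, v] (EFin \o h).
  by apply: continuous_compact_integrable => //; exact: segment_compact.
have {}ih : mu.-integrable (`[u, v] `\` [set u; v]) (EFin \o h).
  by apply: integrableS ih.
apply: eq_integrable ih => //.
move=> t; rewrite inE /= in_itv /= => -[/andP[ut tv] /not_orP[tu tnv]].
by rewrite fh// !lt_neqAle ut tv !andbT eq_sym; apply/andP; split; apply/eqP.
Qed.

Lemma inner_continuous_FTC f G u v : u < v -> inner_continuous f u v ->
  continuous G -> (forall t, u < t < v -> is_derive t 1 G (f t)) ->
  \int[mu]_(t in `[u, v]) f t = G v - G u.
Proof.
move=> uv H cG dG; have mf := inner_continuous_measurable H.
have [h ch fh] := H.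
transitivity (\int[mu]_(t in `[u, v]) h t).
  rewrite /Rintegral; congr fine.
  have mh := continuous_measurable_oo ch.
  rewrite [LHS]integral_itv_bndoo; last exact/measurable_EFinP.
  rewrite [RHS]integral_itv_bndoo; last exact/measurable_EFinP.
  apply: eq_integral => t; rewrite inE /= in_itv /= => tuv.
  by rewrite fh.
rewrite /Rintegral (continuous_FTC2 uv ch (F := G))//.
- split; first by move=> t; rewrite in_itv /= => /dG [].
  + exact/cvg_at_right_filter/cG.
  + exact/cvg_at_left_filter/cG.
- move=> t; rewrite in_itv /= => tuv; rewrite derive1E -fh//.
  by have [_] := dG _ tuv.
Qed.

(** Integrability of f, and the fundamental theorem of calculus for a
    continuous G whose derivative inside each piece of a subdivision is f, where
    f extends continuously to the end points of the piece. *)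
Lemma piecewise_integral (s : seq R) (a b : R) f :
  path <%R a s -> last a s = b -> s != [::] ->
  (forall j, (j < size s)%N ->
     inner_continuous f (nth 0 (a :: s) j) (nth 0 s j)) ->
  mu.-integrable `[a, b] (EFin \o f) /\
  forall G, continuous G ->
    (forall j, (j < size s)%N -> forall t, nth 0 (a :: s) j < t < nth 0 s j ->
       is_derive t 1 G (f t)) ->
    \int[mu]_(t in `[a, b]) f t = G b - G a.
Proof.
move=> ps sb s0 Hf; rewrite -sb.
have sorted_nth j : (j < size s)%N -> nth 0 (a :: s) j < nth 0 s j.
  by move=> js; move/(pathP 0) : ps; exact.
pose I u v := u < v /\ mu.-integrable `[u, v] (EFin \o f).
have It u v w : u < v -> v < w -> I u v -> I v w -> I u w.
  move=> uv vw [_ fuv] [_ fvw]; split; first exact: lt_trans vw.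
  exact: integrable_segment_cat fvw.
have Ij j : (j < size s)%N -> I (nth 0 (a :: s) j) (nth 0 s j).
  move=> js; split; first exact: sorted_nth.
  by apply: inner_continuous_integrable; [exact: sorted_nth | exact: Hf].
split=> [|G cG dG]; first by have [_ []] := subdivision_ind It ps s0 Ij.
pose Q u v := I u v /\ \int[mu]_(t in `[u, v]) f t = G v - G u.
have Qt u v w : u < v -> v < w -> Q u v -> Q v w -> Q u w.
  move=> uv vw [Iuv Euv] [Ivw Evw]; have Iuw := It _ _ _ uv vw Iuv Ivw.
  split=> //.
  have := @Rintegral_itvB _ f (BLeft u) (BRight w) v Iuw.2.
  rewrite !bnd_simp !ltW// => /(_ isT isT).
  rewrite Rintegral_itv_obnd_cbnd; last first.
    by apply: integrableS (Ivw.2) => //; apply: subset_itvr; rewrite bnd_simp.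
  by rewrite Euv Evw; lra.
have [|_ []//] := subdivision_ind Qt ps s0 _.
move=> j js; split; first exact: Ij.
by apply: inner_continuous_FTC;
  [exact: sorted_nth | exact: Hf | exact: cG | exact: dG].
Qed.
End PiecewiseIntegrals.

(** * Derivatives of complex functions of a real variable *)

Section ComplexDerivatives.
Variable R : realType.
Local Notation C := R[i].
Implicit Types (f g l : R -> C) (t : R) (d : C).

(** [d] is the derivative at t of a complex function of a real variable. *)
Definition cderiv f t d :=
  is_derive t 1 (fun s => complex.Re (f s)) (complex.Re d) /\
  is_derive t 1 (fun s => complex.Im (f s)) (complex.Im d).

Lemma is_derive_mul (f g : R -> R) t (df dg : R) :
  is_derive t 1 f df -> is_derive t 1 g dg ->
  is_derive t 1 (fun s => f s * g s) (f t * dg + df * g t).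
Proof.
move=> Hf Hg; apply: (is_derive_eq (is_deriveM Hf Hg)).
by rewrite [df * _]mulrC.
Qed.

Lemma is_derive_add (f g : R -> R) t (df dg : R) :
  is_derive t 1 f df -> is_derive t 1 g dg ->
  is_derive t 1 (fun s => f s + g s) (df + dg).
Proof. exact: is_deriveD. Qed.

Lemma is_derive_comb2 (f g : R -> R) t (a b df dg : R) :
  is_derive t 1 f df -> is_derive t 1 g dg ->
  is_derive t 1 (fun s => a * f s + b * g s) (a * df + b * dg).
Proof.
move=> Hf Hg.
have Z (h : R -> R) (k dh : R) : is_derive t 1 h dh ->
    is_derive t 1 (fun s => k * h s) (k * dh).
  by move=> Hh; exact: (is_deriveZ k Hh).
exact: is_derive_add (Z _ _ _ Hf) (Z _ _ _ Hg).
Qed.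

Lemma is_derive_comp1 (f g : R -> R) t (df dg : R) :
  is_derive (g t) 1 f df -> is_derive t 1 g dg ->
  is_derive t 1 (fun s => f (g s)) (df * dg).
Proof. exact: is_derive1_comp. Qed.

Lemma is_derive_eqfun (f g : R -> R) t (d d' : R) :
  is_derive t 1 f d -> (forall s, f s = g s) -> d = d' -> is_derive t 1 g d'.
Proof. by move=> Hf /funext <- <-. Qed.

Lemma cderiv_comb l0 l1 t d0 d1 (a b : C) : cderiv l0 t d0 -> cderiv l1 t d1 ->
  cderiv (fun s => a * l0 s + b * l1 s) t (a * d0 + b * d1).
Proof.
move=> [r0 i0] [r1 i1]; split.
  apply: is_derive_eqfun (is_derive_add
    (is_derive_comb2 (complex.Re a) (- complex.Im a) r0 i0)
    (is_derive_comb2 (complex.Re b) (- complex.Im b) r1 i1)) _ _.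
    by move=> s; rewrite ReD !ReM !mulNr.
  by rewrite ReD !ReM !mulNr.
apply: is_derive_eqfun (is_derive_add
  (is_derive_comb2 (complex.Re a) (complex.Im a) i0 r0)
  (is_derive_comb2 (complex.Re b) (complex.Im b) i1 r1)) _ _.
  by move=> s; rewrite ImD !ImM.
by rewrite ImD !ImM.
Qed.

Lemma cderiv_cexp l t d : cderiv l t d ->
  cderiv (fun s => cexp (l s)) t (cexp (l t) * d).
Proof.
move=> [r i].
have e := is_derive_comp1 (is_derive_expR _) r.
have c := is_derive_comp1 (is_derive_cos _) i.
have s := is_derive_comp1 (is_derive_sin _) i.
split.
  apply: is_derive_eqfun (is_derive_mul e c) _ _ => //.
  by rewrite ReM /=; ring.
apply: is_derive_eqfun (is_derive_mul e s) _ _ => //.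
by rewrite ImM /=; ring.
Qed.

Lemma cexpD (z w : C) : cexp (z + w) = cexp z * cexp w.
Proof.
apply: complex_eq; rewrite ?ReM ?ImM /= ReD ImD expRD ?cosD ?sinD; ring.
Qed.

Lemma cexp0 : cexp 0 = 1 :> C.
Proof. by apply: complex_eq; rewrite /= expR0 ?cos0 ?sin0 ?mulr1 ?mulr0. Qed.

Lemma cexpN (z : C) : cexp (- z) = (cexp z)^-1.
Proof.
have h : cexp (- z) * cexp z = 1 by rewrite -cexpD addNr cexp0.
have z0 : cexp z != 0.
  apply/eqP => z0; move: h; rewrite z0 mulr0 => /eqP.
  by rewrite eq_sym oner_eq0.
by apply: (mulIf z0); rewrite h mulVf.
Qed.

(** Any continuous logarithm l of a differentiable g has derivative g' / g. *)
Lemma cderiv_log g l t d :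
  {for t, continuous (fun s => complex.Im (l s))} ->
  (\forall s \near t, cexp (l s) = g s) ->
  cderiv g t d -> cderiv l t (d * cexp (- l t)).
Proof.
move=> ci lg [dr di].
pose x s := complex.Re (g s); pose y s := complex.Im (g s).
pose r := expR (complex.Re (l t)); pose th := complex.Im (l t).
have r0 : 0 < r by exact: expR_gt0.
have rn0 : r != 0 by rewrite gt_eqF.
have gt := nbhs_singleton lg.
have xt : x t = r * cos th by rewrite /x -gt.
have yt : y t = r * sin th by rewrite /y -gt.
have cs := cos2Dsin2 th.
have n2 : x t ^+ 2 + y t ^+ 2 = r ^+ 2.
  by rewrite xt yt !exprMn -mulrDr cs mulr1.
have rV : expR (- complex.Re (l t)) = r^-1 by rewrite expRN.
split.
  (* Re l = ln (x^2 + y^2) / 2 *)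
  have dn := is_derive_add (is_derive_mul dr dr) (is_derive_mul di di).
  have n0 : 0 < x t * x t + y t * y t by rewrite -!expr2 n2 exprn_gt0.
  have dln := is_derive_comp1 (f := @ln R)
    (g := fun s => x s * x s + y s * y s) (is_derive1_ln n0) dn.
  have d2 := is_derive_comb2 2^-1 0 dln dln.
  apply: (@near_eq_is_derive _ _ _
    (fun s => 2^-1 * ln (x s * x s + y s * y s) + 0 * ln (x s * x s + y s * y s))).
    apply: filterS lg => s ls; rewrite mul0r addr0 /x /y -ls /= -!expr2 !exprMn.
    by rewrite -mulrDr cos2Dsin2 mulr1 -expRM_natl expRK mulKf.
  apply: is_derive_eq d2 _.
  rewrite mul0r addr0 ReM /= ReN ImN cosN sinN rV -/(x t) -/(y t).
  rewrite -!expr2 n2 -/th xt yt; field.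
  exact: rn0.
(* Near t, Im l differs from its value at t by the argument of
   g s * conj (g t), which is an arctangent. *)
have da := is_derive_comb2 (x t) (y t) dr di.
have db := is_derive_comb2 (x t) (- y t) di dr.
have at0 : x t * x t + y t * y t = r ^+ 2 by rewrite -!expr2.
have bt0 : x t * y t + - y t * x t = 0 by ring.
have an0 : x t * x t + y t * y t != 0 by rewrite at0 expf_neq0.
have dV := is_deriveV (f := fun s => x t * x s + y t * y s) an0 da.
have dq := is_derive_mul (f := fun s => x t * y s + - y t * x s)
  (g := fun s => (x t * x s + y t * y s)^-1) db dV.
have dat := is_derive_comp1 (f := @atan R)
  (g := fun s => (x t * y s + - y t * x s) * (x t * x s + y t * y s)^-1)
  (is_derive1_atan _) dq.
have dth := is_derive_add (f := fun=> th) (is_derive_cst th t 1) dat.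
apply: (near_eq_is_derive _ (is_derive_eq dth _)).
  have near_pi : \forall s \near t, `|th - complex.Im (l s)| < pi / 2.
    by apply: cvgr_dist_lt ci _ _; rewrite divr_gt0// pi_gt0.
  near=> s.
  have lgs : cexp (l s) = g s by near: s.
  have : `|th - complex.Im (l s)| < pi / 2 by near: s.
  rewrite ltr_norml => /andP[lo hi].
  pose e := complex.Im (l s) - th.
  have e_itv : e \in `](- (pi / 2)), (pi / 2)[.
    by rewrite in_itv /= /e; apply/andP; split; lra.
  have ce : 0 < cos e by apply: cos_gt0_pihalf; move: e_itv; rewrite in_itv.
  rewrite /x /y -/(x t) -/(y t) -lgs /= xt yt.
  set rs := expR (complex.Re (l s)); set ths := complex.Im (l s).
  have rs0 : rs != 0 by rewrite gt_eqF// expR_gt0.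
  have -> : (r * cos th * (rs * sin ths) + - (r * sin th) * (rs * cos ths)) *
      (r * cos th * (rs * cos ths) + r * sin th * (rs * sin ths))^-1 = tan e.
    rewrite /tan /e -/ths; move: ce; rewrite /e -/ths sinB cosB => ce.
    field.
    have -> : r * cos th * (rs * cos ths) + r * sin th * (rs * sin ths) =
      r * rs * (cos ths * cos th + sin ths * sin th) by ring.
    by rewrite !mulf_neq0 ?(gt_eqF ce).
  by rewrite (tanK e_itv) /e -/ths; ring.
rewrite add0r bt0 at0 ImM /= ReN ImN cosN sinN rV -/th.
rewrite -/(x t) -/(y t) xt yt.
by field.
Unshelve. all: by end_near.
Qed.
End ComplexDerivatives.

(** * Contour integrals *)

Section ComplexIntegrals.
Variable R : realType.
Local Notation C := R[i].
Local Notation mu := (@lebesgue_measure R).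
Local Notation unitI := (`[0, 1]%classic : set R).
Implicit Types (f g F : R -> C).

(** Integrability and integral over [0, 1], componentwise. *)
Definition cintegrable F :=
  mu.-integrable unitI (EFin \o (fun t => complex.Re (F t))) /\
  mu.-integrable unitI (EFin \o (fun t => complex.Im (F t))).

Definition cintegral F : C :=
  (\int[mu]_(t in unitI) complex.Re (F t))
  +i* (\int[mu]_(t in unitI) complex.Im (F t)).

Lemma eq_cintegral F F' : (forall t, 0 <= t <= 1 -> F t = F' t) ->
  cintegral F = cintegral F'.
Proof.
by move=> FF'; congr (_ +i* _); apply: eq_Rintegral => t;
  rewrite inE /= in_itv /= => /FF' ->.
Qed.

Lemma integrable_comb2 (x y : R -> R) (a b : R) :
  mu.-integrable unitI (EFin \o x) -> mu.-integrable unitI (EFin \o y) ->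
  mu.-integrable unitI (EFin \o (fun t => a * x t + b * y t)) /\
  \int[mu]_(t in unitI) (a * x t + b * y t) =
  a * \int[mu]_(t in unitI) x t + b * \int[mu]_(t in unitI) y t.
Proof.
move=> ix iy.
have iax : mu.-integrable unitI (EFin \o (fun t => a * x t)) 
  by apply: eq_integrable (integrableZl _ a ix).
have iby : mu.-integrable unitI (EFin \o (fun t => b * y t)) 
  by apply: eq_integrable (integrableZl _ b iy).
split; first by apply: eq_integrable (integrableD _ iax iby).
by rewrite RintegralD// !RintegralZl.
Qed.

Lemma cintegrableZ (c : C) F : cintegrable F ->
  cintegrable (fun t => c * F t) /\
  cintegral (fun t => c * F t) = c * cintegral F.
Proof.
move=> [iR iI].
have [i1 e1] := integrable_comb2 (complex.Re c) (- complex.Im c) iR iI.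
have [i2 e2] := integrable_comb2 (complex.Re c) (complex.Im c) iI iR.
have ER : (fun t => complex.Re (c * F t)) =
    fun t => complex.Re c * complex.Re (F t)
      + - complex.Im c * complex.Im (F t).
  by apply/funext => t; rewrite ReM mulNr.
have EI : (fun t => complex.Im (c * F t)) =
    fun t => complex.Re c * complex.Im (F t) + complex.Im c * complex.Re (F t).
  by apply/funext => t; rewrite ImM.
split; first by split; rewrite ?ER ?EI.
rewrite /cintegral ER EI e1 e2.
by apply: complex_eq; rewrite ?ReM ?ImM /= ?mulNr.
Qed.

Lemma cintegrableD F F' : cintegrable F -> cintegrable F' ->
  cintegrable (fun t => F t + F' t) /\
  cintegral (fun t => F t + F' t) = cintegral F + cintegral F'.
Proof.
move=> [iR iI] [iR' iI'].
have [i1 e1] := integrable_comb2 1 1 iR iR'.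
have [i2 e2] := integrable_comb2 1 1 iI iI'.
have ER : (fun t => complex.Re (F t + F' t)) =
    fun t => 1 * complex.Re (F t) + 1 * complex.Re (F' t).
  by apply/funext => t; rewrite ReD !mul1r.
have EI : (fun t => complex.Im (F t + F' t)) =
    fun t => 1 * complex.Im (F t) + 1 * complex.Im (F' t).
  by apply/funext => t; rewrite ImD !mul1r.
split; first by split; rewrite ?ER ?EI.
rewrite /cintegral ER EI e1 e2 !mul1r.
by apply: complex_eq; rewrite ?ReD ?ImD.
Qed.

Lemma cintegral0 : cintegrable (fun=> 0) /\ cintegral (fun=> 0) = 0.
Proof.
have i0 : mu.-integrable unitI (EFin \o (fun=> 0)) by exact: integrable0.
split=> //; rewrite /cintegral /= -[X in X +i* X]mulr1 /Rintegral integral0 /=.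
by apply: complex_eq; rewrite /= mul0r.
Qed.

Lemma cintegral_sum (T : Type) (r : seq T) (c : T -> C) (F : T -> R -> C) :
  (forall i, cintegrable (F i)) ->
  cintegrable (fun t => \sum_(i <- r) c i * F i t) /\
  cintegral (fun t => \sum_(i <- r) c i * F i t) =
  \sum_(i <- r) c i * cintegral (F i).
Proof.
move=> iF; elim: r => [|i r [IHi IHe]].
  under [X in cintegrable X]eq_fun do rewrite big_nil.
  under [X in cintegral X]eq_fun do rewrite big_nil.
  by rewrite big_nil; exact: cintegral0.
under [X in cintegrable X]eq_fun do rewrite big_cons.
under [X in cintegral X]eq_fun do rewrite big_cons.
have [iZ eZ] := cintegrableZ (c i) (iF i).
have [iD eD] := cintegrableD iZ IHi.
by split=> //; rewrite eD eZ IHe big_cons.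
Qed.

Lemma contour_integralE g f :
  contour_integral g f = cintegral (fun t => f t * Cderive g t).
Proof. by []. Qed.

(** The weak integral of a combination of fixed vectors. *)
Lemma vcontour_integral_comb (V : lmodType C) g m (f : 'I_m -> R -> C)
    (e : 'I_m -> V) (Phi : R -> V) :
  (forall i, cintegrable (fun t => f i t * Cderive g t)) ->
  (forall t, 0 <= t <= 1 -> Phi t = \sum_i f i t *: e i) ->
  vcontour_integral g Phi = \sum_i contour_integral g (f i) *: e i.
Proof.
move=> fi PhiE; set v := \sum_i _.
have vP : is_contour_integral g Phi v.
  move=> phi; rewrite contour_integralE /v linear_sum /=.
  have [_ E] := cintegral_sum (index_enum 'I_m) (fun i => phi (e i)) fi.
  transitivity (\sum_i phi (e i) * cintegral (fun t => f i t * Cderive g t)).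
    by apply: eq_bigr => i _; rewrite linearZ /= mulrC.
  rewrite -E; apply: eq_cintegral => t /PhiE ->.
  rewrite linear_sum /= mulr_suml; apply: eq_bigr => i _.
  by rewrite linearZ /= mulrA [phi _ * _]mulrC.
rewrite /vcontour_integral; case: xgetP => [w _ wP|/(_ v)]; last by [].
apply/eqP; rewrite -subr_eq0; apply/negPn/negP => /linear_form_separates[phi].
by rewrite linearB /= wP vP subrr eqxx.
Qed.

End ComplexIntegrals.

(** * Euler integrals *)

Section EulerIntegrals.
Variable R : realType.
Local Notation C := R[i].
Local Notation mu := (@lebesgue_measure R).
Implicit Types (f l : R -> C).

(** Componentwise continuity on the whole line. *)
Definition ccontinuous f :=
  continuous (fun t => complex.Re (f t)) /\
  continuous (fun t => complex.Im (f t)).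

Lemma ccontinuousD f f' : ccontinuous f -> ccontinuous f' ->
  ccontinuous (fun t => f t + f' t).
Proof.
move=> [a b] [a' b']; split.
  by under eq_fun do rewrite ReD; move=> t; apply: cvgD; [exact: a | exact: a'].
by under eq_fun do rewrite ImD; move=> t; apply: cvgD; [exact: b | exact: b'].
Qed.

Lemma ccontinuousM f f' : ccontinuous f -> ccontinuous f' ->
  ccontinuous (fun t => f t * f' t).
Proof.
move=> [a b] [a' b']; split.
  under eq_fun do rewrite ReM; move=> t; apply: cvgB.
    by apply: cvgM; [exact: a | exact: a'].
  by apply: cvgM; [exact: b | exact: b'].
under eq_fun do rewrite ImM; move=> t; apply: cvgD.
  by apply: cvgM; [exact: a | exact: b'].
by apply: cvgM; [exact: b | exact: a'].
Qed.

Lemma ccontinuous_cst (c : C) : ccontinuous (fun=> c).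
Proof. by split=> t; exact: cvg_cst. Qed.

Lemma ccontinuous_cexp l : ccontinuous l -> ccontinuous (fun t => cexp (l t)).
Proof.
move=> [a b].
have e t : expR (complex.Re (l s)) @[s --> t] --> expR (complex.Re (l t)).
  exact: (continuous_comp (a t) (@continuous_expR _ _)).
have c t : cos (complex.Im (l s)) @[s --> t] --> cos (complex.Im (l t)).
  exact: (continuous_comp (b t) (@continuous_cos _ _)).
have s t : sin (complex.Im (l s)) @[s --> t] --> sin (complex.Im (l t)).
  exact: (continuous_comp (b t) (@continuous_sin _ _)).
by split=> t; [exact: (cvgM (e t) (c t)) | exact: (cvgM (e t) (s t))].
Qed.

Lemma Ccontinuous_on_clamp f :
  Ccontinuous_on (`[0, 1]%classic : set R) f ->
  ccontinuous (fun t => f (clamp t)).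
Proof.
move=> [a b].
have cl t : `[0%R, 1%R]%classic (clamp t).
  by rewrite /= in_itv /=; exact: clamp01.
split; first by apply: (within_comp a) => //; exact: continuous_clamp.
by apply: (within_comp b) => //; exact: continuous_clamp.
Qed.

Lemma subdivision_bounds (s : seq R) j : path <%R 0 s -> last 0 s = 1 ->
  (j < size s)%N -> 0 <= nth 0 (0 :: s) j /\ nth 0 s j <= 1.
Proof.
move=> ps sl js.
have so : sorted <=%R (0 :: s) by apply: sub_path ps => x y /ltW.
have mono := sorted_leq_nth le_trans lexx 0 so.
split.
  by have := mono 0%N j; rewrite !inE /= ltnS => /(_ isT (ltnW js) (leq0n _)).
have := mono j.+1 (size s); rewrite !inE /= !ltnS => /(_ js (leqnn _) js).
rewrite (_ : nth 0 (0 :: s) (size s) = 1) //.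
by rewrite -sl -[last 0 s]/(last 0 (0 :: s)) -nth_last.
Qed.

(* The logarithms of gamma and gamma - 1 are defined and continuous on the
   whole line, but related to gamma on [0, 1] only. *)
Variables (gamma l0 l1 : R -> C).
Hypothesis gamma_C1 : piecewise_C1 gamma.
Hypothesis l0_cont : ccontinuous l0.
Hypothesis l1_cont : ccontinuous l1.
Hypothesis l0_log : forall t, 0 <= t <= 1 -> cexp (l0 t) = gamma t.
Hypothesis l1_log : forall t, 0 <= t <= 1 -> cexp (l1 t) = gamma t - 1.
Hypothesis l0_closed : l0 1 = l0 0.
Hypothesis l1_closed : l1 1 = l1 0.

(** The branch of z^a (z - 1)^b along gamma given by l0 and l1. *)
Definition monomial (a b : C) (t : R) : C := cexp (a * l0 t + b * l1 t).

Local Notation J a b := (contour_integral gamma (monomial a b)).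

Lemma monomial_continuous a b : ccontinuous (monomial a b).
Proof.
by apply: ccontinuous_cexp; apply: ccontinuousD; apply: ccontinuousM => //;
  exact: ccontinuous_cst.
Qed.

Lemma piece_deriv (h : R -> C) u v t : C1 h ->
  (forall s, u <= s <= v -> gamma s = h s) -> u < t < v ->
  cderiv gamma t (Cderive gamma t) /\ Cderive gamma t = Cderive h t.
Proof.
move=> [dh _] gh tuv.
have near_uv : \forall s \near t, u < s < v.
  by apply: near_in_itvoo; rewrite in_itv.
have nearRe : \forall s \near t, complex.Re (h s) = complex.Re (gamma s).
  by apply: filterS near_uv => s /andP[/ltW us /ltW sv]; rewrite gh ?us.
have nearIm : \forall s \near t, complex.Im (h s) = complex.Im (gamma s).
  by apply: filterS near_uv => s /andP[/ltW us /ltW sv]; rewrite gh ?us.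
have [dR dI] := dh t.
have isR := near_eq_is_derive nearRe (derivableP dR).
have isI := near_eq_is_derive nearIm (derivableP dI).
have E : Cderive gamma t = Cderive h t.
  apply: complex_eq; rewrite /= !derive1E.
    by have [_ ->] := isR.
  by have [_ ->] := isI.
by split=> //; rewrite E; split; rewrite /= derive1E.
Qed.

Lemma pieces : exists2 s : seq R,
  [/\ path <%R 0 s, last 0 s = 1 & s != [::]] &
  forall j, (j < size s)%N -> exists2 h : R -> C, C1 h &
    forall t, nth 0 (0 :: s) j < t < nth 0 s j ->
      [/\ 0 < t < 1, cderiv gamma t (Cderive gamma t)
        & Cderive gamma t = Cderive h t].
Proof.
have [s [ps sl Hs]] := gamma_C1; exists s.
  split=> //; apply/eqP => s0; move: sl; rewrite s0 /= => /eqP.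
  by rewrite eq_sym oner_eq0.
move=> j js; have [h hC1 gh] := Hs j js; exists h => // t tj.
have [d e] := piece_deriv hC1 gh tj.
have [b1 b2] := subdivision_bounds ps sl js.
split=> //; move/andP: tj => [t1 t2].
by rewrite (le_lt_trans b1 t1) (lt_le_trans t2 b2).
Qed.

Lemma integrand_inner_continuous F h u v : ccontinuous F -> C1 h ->
  (forall t, u < t < v -> Cderive gamma t = Cderive h t) ->
  inner_continuous (fun t => complex.Re (F t * Cderive gamma t)) u v /\
  inner_continuous (fun t => complex.Im (F t * Cderive gamma t)) u v.
Proof.
move=> cF [_ [hR hI]] gh.
have ch : ccontinuous (Cderive h) by split; exact/continuous_subspace_setT.
have [cR cI] := ccontinuousM cF ch.
by split; [exists (fun t => complex.Re (F t * Cderive h t))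
  | exists (fun t => complex.Im (F t * Cderive h t))];
  [exact: continuous_subspaceT|by move=> t /gh ->
  |exact: continuous_subspaceT|by move=> t /gh ->].
Qed.

Lemma monomial_deriv a b t : 0 < t < 1 -> cderiv gamma t (Cderive gamma t) ->
  cderiv (monomial a b) t
    ((a * monomial (a - 1) b t + b * monomial a (b - 1) t) * Cderive gamma t).
Proof.
move=> t01 dg.
have near01 : \forall s \near t, 0 <= s <= 1.
  have n : \forall s \near t, 0 < s < 1 by apply: near_in_itvoo; rewrite in_itv.
  by apply: filterS n => s /andP[/ltW -> /ltW ->].
have d0 : cderiv l0 t (Cderive gamma t * cexp (- l0 t)).
  apply: cderiv_log dg; first by case: l0_cont => _; apply.
  by apply: filterS near01 => s /l0_log.
have dg1 : cderiv (fun s => gamma s - 1) t (Cderive gamma t).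
  case: dg => dR dI; split.
    have h := is_derive_add (g := fun=> -1) dR (is_derive_cst (-1 : R) t 1).
    apply: (is_derive_eqfun h); last by rewrite addr0.
    by move=> s; rewrite ReD ReN.
  apply: is_derive_eqfun dI _ erefl => s.
  by rewrite ImD ImN /= oppr0 addr0.
have d1 : cderiv l1 t (Cderive gamma t * cexp (- l1 t)).
  apply: cderiv_log dg1; first by case: l1_cont => _; apply.
  by apply: filterS near01 => s /l1_log.
have := cderiv_cexp (cderiv_comb a b d0 d1).
rewrite -/(monomial a b t); congr cderiv.
have -> : monomial (a - 1) b t = monomial a b t * cexp (- l0 t).
  by rewrite /monomial -cexpD; congr cexp; ring.
have -> : monomial a (b - 1) t = monomial a b t * cexp (- l1 t).
  by rewrite /monomial -cexpD; congr cexp; ring.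
by ring.
Qed.

Lemma integrable_along F : ccontinuous F ->
  cintegrable (fun t => F t * Cderive gamma t).
Proof.
move=> cF; have [s [ps sl s0] Hs] := pieces.
have H j (js : (j < size s)%N) : _ := let: ex_intro2 h hC hE := Hs j js in
  integrand_inner_continuous cF hC (fun t tj =>
    let: And3 _ _ e := hE t tj in e).
split.
  by have [] := piecewise_integral ps sl s0 (fun j js => (H j js).1).
by have [] := piecewise_integral ps sl s0 (fun j js => (H j js).2).
Qed.

Lemma contour_integral_deriv (F G : R -> C) : ccontinuous F -> ccontinuous G ->
  (forall t, 0 < t < 1 -> cderiv gamma t (Cderive gamma t) ->
     cderiv G t (F t * Cderive gamma t)) ->
  contour_integral gamma F = G 1 - G 0.
Proof.
move=> cF [cGR cGI] dG; have [s [ps sl s0] Hs] := pieces.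
have H j (js : (j < size s)%N) : _ := let: ex_intro2 h hC hE := Hs j js in
  integrand_inner_continuous cF hC (fun t tj =>
    let: And3 _ _ e := hE t tj in e).
have [_ IR] := piecewise_integral ps sl s0 (fun j js => (H j js).1).
have [_ II] := piecewise_integral ps sl s0 (fun j js => (H j js).2).
apply: complex_eq; rewrite ?ReD ?ReN ?ImD ?ImN /=.
  apply: (IR _ cGR) => j js t tj; have [h _ hE] := Hs j js.
  by have [t01 dg _] := hE t tj; have [] := dG t t01 dg.
apply: (II _ cGI) => j js t tj; have [h _ hE] := Hs j js.
by have [t01 dg _] := hE t tj; have [] := dG t t01 dg.
Qed.

Lemma contour_integral_comb2 a b a' b' c c' :
  contour_integral gamma (fun t => c * monomial a b t + c' * monomial a' b' t) =
  c * J a b + c' * J a' b'.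
Proof.
have i1 := integrable_along (monomial_continuous a b).
have i2 := integrable_along (monomial_continuous a' b').
have [j1 e1] := cintegrableZ c i1; have [j2 e2] := cintegrableZ c' i2.
have [_ e] := cintegrableD j1 j2.
rewrite !contour_integralE -e1 -e2 -e.
by apply: eq_cintegral => t _; ring.
Qed.

(** The integral of d(z^a (z - 1)^b) vanishes. *)
Lemma monomial_by_parts a b : a * J (a - 1) b + b * J a (b - 1) = 0.
Proof.
rewrite -contour_integral_comb2 (contour_integral_deriv (G := monomial a b)).
- by rewrite /monomial l0_closed l1_closed subrr.
- apply: ccontinuousD; apply: ccontinuousM; try exact: ccontinuous_cst;
    exact: monomial_continuous.
- exact: monomial_continuous.
- exact: monomial_deriv.
Qed.

(** The consequence of z - (z - 1) = 1. *)
Lemma monomial_split a b : J (a + 1) b - J a (b + 1) = J a b.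
Proof.
rewrite -[X in X - _]mul1r -mulN1r -contour_integral_comb2 !contour_integralE.
apply: eq_cintegral => t t01.
have -> : monomial (a + 1) b t = monomial a b t * gamma t.
  by rewrite -l0_log// /monomial -cexpD; congr cexp; ring.
have -> : monomial a (b + 1) t = monomial a b t * (gamma t - 1).
  by rewrite -l1_log// /monomial -cexpD; congr cexp; ring.
by ring.
Qed.

Lemma monomial_lower0 a b : a * J (a - 1) b = (a + b + 1) * J a b.
Proof.
have h1 := monomial_by_parts a (b + 1); rewrite addrK in h1.
have h2 := monomial_split (a - 1) b; rewrite subrK in h2.
have -> : J (a - 1) b = J a b - J (a - 1) (b + 1) by rewrite -h2; ring.
by rewrite mulrBr -[X in _ - X](addrK ((b + 1) * J a b)) h1; ring.
Qed.

Lemma monomial_lower1 a b : b * J a (b - 1) = - (a + b + 1) * J a b.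
Proof.
have h1 := monomial_by_parts (a + 1) b; rewrite addrK in h1.
have h2 := monomial_split a (b - 1); rewrite subrK in h2.
have -> : J a (b - 1) = J (a + 1) (b - 1) - J a b by rewrite -h2; ring.
by rewrite mulrBr -[X in X - _](addKr ((a + 1) * J a b)) h1; ring.
Qed.

Lemma ffactrS (x : C) m : ffactr x m.+1 = ffactr x m * (x - m%:R).
Proof. by rewrite /ffactr big_ord_recr. Qed.

(** Euler's relation, with falling factorials; it holds without any genericity
    assumption on a and b. *)
Lemma euler_integral_ratio a b p q :
  ffactr a p * ffactr b q * J (a - p%:R) (b - q%:R) =
  (-1) ^+ q * ffactr (a + b + 1) (p + q) * J a b.
Proof.
elim: q => [|q IHq].
  rewrite subr0 addn0 /ffactr big_ord0 expr0 -/(ffactr a p).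
  rewrite -/(ffactr _ p) mulr1 mul1r.
  elim: p => [|p IHp]; first by rewrite subr0 /ffactr !big_ord0.
  rewrite !ffactrS.
  have -> : a - p.+1%:R = a - p%:R - 1 by rewrite -natr1; ring.
  rewrite -mulrA monomial_lower0 mulrCA IHp; ring.
rewrite addnS !ffactrS exprS.
have -> : b - q.+1%:R = b - q%:R - 1 by rewrite -natr1; ring.
transitivity (ffactr a p * ffactr b q *
    ((b - q%:R) * J (a - p%:R) (b - q%:R - 1))).
  by ring.
rewrite monomial_lower1 mulrCA IHq natrD; ring.
Qed.

Lemma monomial_shift a b p q t : 0 <= t <= 1 ->
  monomial (a - p%:R) (b - q%:R) t =
  monomial a b t * (gamma t)^-1 ^+ p * (gamma t - 1)^-1 ^+ q.
Proof.
move=> t01; rewrite -l1_log// -l0_log// -!cexpN.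
have E (z : C) k : cexp z ^+ k = cexp (k%:R * z).
  elim: k => [|k IH]; rewrite ?mul0r ?cexp0//.
  by rewrite exprS IH -cexpD -natr1; congr cexp; ring.
by rewrite !E -!cexpD /monomial; congr cexp; ring.
Qed.

End EulerIntegrals.

(** * The two states as contour integrals *)

Lemma PpowE (R : realType) (k1 k2 : R[i]) (l0 l1 : R -> R[i]) (s : R[i]) t :
  Ppow k1 k2 l0 l1 s t = monomial l0 l1 (s * k1) (s * k2) t.
Proof. by rewrite /Ppow /monomial mulrDr !mulrA. Qed.

(** The normalized integral of a branch of P(z)^s against a combination of the
    vectors e_i with coefficients z^-(d - i) (z - 1)^-i.  The falling factorials
    in the denominators are nonzero because so are their products with the
    integrals, by Euler's relation. *)
Lemma normalized_contour_integral (R : realType) (V : lmodType R[i])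
    (k1 k2 s : R[i])
    (gamma l0 l1 : R -> R[i]) (d : nat) (e : nat -> V) (Phi : R -> V) :
  pochhammer_contour gamma -> log_along gamma l0 ->
  log_along (fun t => gamma t - 1) l1 ->
  (forall t, 0 <= t <= 1 -> Phi t = Ppow k1 k2 l0 l1 s t *:
    \sum_(i < d.+1) ((gamma t)^-1 ^+ (d - i) * (gamma t - 1)^-1 ^+ i) *: e i) ->
  let P := contour_integral gamma (Ppow k1 k2 l0 l1 s) in
  let x := s * k1 in let y := s * k2 in
  ffactr (x + y + 1) d != 0 -> P != 0 ->
  [/\ ffactr x d != 0, ffactr y d != 0 &
    P^-1 *: vcontour_integral gamma Phi = \sum_(i < d.+1)
      ((-1) ^+ i * ffactr (x + y + 1) d
       / (ffactr x (d - i) * ffactr y i)) *: e i].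
Proof.
move=> gp log0 log1 PhiE P x y S0 P0.
have log0' : log_along (fun t => gamma t - 0) l0.
  by rewrite (_ : (fun t => _) = gamma)//; apply/funext => t; rewrite subr0.
have z0 : (0 == 0 :> R[i]) || (0 == 1 :> R[i]) by rewrite eqxx.
have z1 : (1 == 0 :> R[i]) || (1 == 1 :> R[i]) by rewrite eqxx orbT.
have closed0 := pochhammer_log_closed z0 gp log0'.
have closed1 := pochhammer_log_closed z1 gp log1.
pose L0 t := l0 (clamp t); pose L1 t := l1 (clamp t).
have cL0 : ccontinuous L0 by apply: Ccontinuous_on_clamp; case: log0.
have cL1 : ccontinuous L1 by apply: Ccontinuous_on_clamp; case: log1.
have c1 : clamp 1 = 1 :> R by rewrite clamp_id ?lexx ?ler01.
have c0 : clamp 0 = 0 :> R by rewrite clamp_id ?lexx ?ler01.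
have E0 t : 0 <= t <= 1 -> cexp (L0 t) = gamma t.
  by move=> t01; rewrite /L0 clamp_id//; case: log0 => _; apply.
have E1 t : 0 <= t <= 1 -> cexp (L1 t) = gamma t - 1.
  by move=> t01; rewrite /L1 clamp_id//; case: log1 => _; apply.
have cl0 : L0 1 = L0 0 by rewrite /L0 c0 c1.
have cl1 : L1 1 = L1 0 by rewrite /L1 c0 c1.
have gC1 : piecewise_C1 gamma by case: gp.
have PE t : 0 <= t <= 1 -> Ppow k1 k2 l0 l1 s t = monomial L0 L1 x y t.
  by move=> t01; rewrite PpowE /monomial /L0 /L1 clamp_id.
pose J i := contour_integral gamma (monomial L0 L1 (x - (d - i)%:R) (y - i%:R)).
have JE i : (i <= d)%N ->
    ffactr x (d - i) * ffactr y i * J i = (-1) ^+ i * ffactr (x + y + 1) d * P.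
  move=> id; have := euler_integral_ratio gC1 cL0 cL1 E0 E1 cl0 cl1 x y (d - i) i.
  rewrite subnK// => ->; congr (_ * _); rewrite /P !contour_integralE.
  by apply: eq_cintegral => t t01; rewrite PE.
have f0 i : (i <= d)%N -> ffactr x (d - i) * ffactr y i != 0.
  move=> id; have : ffactr x (d - i) * ffactr y i * J i != 0.
    by rewrite JE// !mulf_neq0// signr_eq0.
  by rewrite mulf_eq0 negb_or => /andP[].
have fx : ffactr x d != 0.
  by have := f0 0%N isT; rewrite subn0 mulf_eq0 negb_or => /andP[].
have fy : ffactr y d != 0.
  by have := f0 d (leqnn d); rewrite mulf_eq0 negb_or => /andP[].
split=> //.
rewrite (vcontour_integral_comb (f := fun i : 'I_d.+1 =>
    monomial L0 L1 (x - (d - i)%:R) (y - i%:R)) (e := fun i : 'I_d.+1 => e i)).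
- rewrite scaler_sumr; apply: eq_bigr => i _; rewrite scalerA; congr (_ *: _).
  have id : (i <= d)%N by rewrite -ltnS.
  by apply: (mulIf (f0 _ id)); rewrite divfK ?f0// -mulrA
    [J i * _]mulrC JE// mulrC mulfK.
- by move=> i; apply: integrable_along => //; exact: monomial_continuous.
- move=> t t01; rewrite PhiE// PE// scaler_sumr; apply: eq_bigr => i _.
  by rewrite (monomial_shift E0 E1)// scalerA mulrA.
Qed.

Theorem proposition6p2 (R : realType) (M : nat) (k1 k2 : R[i])
    (V : affine_module R M) (vac : V) (n : nat) (I : n.-tuple (sl R M))
    (gamma l0 l1 : R -> R[i])
    (M_ge3 : (3 <= M)%N)
    (k1_noncritical : k1 != - M%:R) (k2_noncritical : k2 != - M%:R)
    (V_induced : induced_vacuum_module k1 k2 vac)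
    (I_basis : orthonormal_basis I)
    (gamma_pochhammer : pochhammer_contour gamma)
    (l0_log : log_along gamma l0)
    (l1_log : log_along (fun t => gamma t - 1) l1) :
  let P1 := Ppow k1 k2 l0 l1 (- (1 / M%:R)) in
  let P2 := Ppow k1 k2 l0 l1 (- (2 / M%:R)) in
  (k1 + k2 + M%:R != 0 -> k1 + k2 != 0 -> k1 + k2 - M%:R != 0 ->
   contour_integral gamma P1 != 0 ->
   omega_state vac I k1 k2 =
   (k1 * k2 / ((k1 + k2 + M%:R) * (k1 + k2) * (k1 + k2 - M%:R))) *:
   ((contour_integral gamma P1)^-1 *:
    vcontour_integral gamma (fun t => P1 t *: varsigma1 vac I (gamma t)))) /\
  (k1 + k2 + M%:R != 0 -> M%:R + 2 * k1 != 0 -> M%:R + 2 * k2 != 0 ->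
   3 * M%:R + 2 * k1 + 2 * k2 != 0 ->
   ffactr (- (2 / M%:R) * k1 - 2 / M%:R * k2 + 1) 3 != 0 ->
   contour_integral gamma P2 != 0 ->
   forall D : R[i], D ^+ 2 = D_square M k1 k2 ->
   W_state vac I D k1 k2 =
   (C_coef M D k1 k2 * ffactr (- (2 / M%:R) * k1) 3
      * ffactr (- (2 / M%:R) * k2) 3
    / ffactr (- (2 / M%:R) * k1 - 2 / M%:R * k2 + 1) 3) *:
   ((contour_integral gamma P2)^-1 *:
    vcontour_integral gamma (fun t => P2 t *: varsigma2 vac I (gamma t)))).
Proof.
move=> P1 P2.
have M0 : M%:R != 0 :> R[i] by rewrite pnatr_eq0; case: (M) M_ge3.
have fE0 (x : R[i]) : ffactr x 0 = 1 by rewrite /ffactr big_ord0.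
have fE1 (x : R[i]) : ffactr x 1 = x by rewrite ffactrS fE0 mul1r subr0.
have fE2 (x : R[i]) : ffactr x 2 = x * (x - 1) by rewrite ffactrS fE1.
have fE3 (x : R[i]) : ffactr x 3 = x * (x - 1) * (x - 2) by rewrite ffactrS fE2.
split.
- move=> h1 h2 h3 hJ.
  pose e := nth 0 [:: 2^-1 *: quad vac I ord0 ord0;
    quad vac I ord0 ord_max; 2^-1 *: quad vac I ord_max ord_max].
  have [t t01|||] := @normalized_contour_integral R V k1 k2
      (- (1 / M%:R)) gamma l0 l1 2 e
    (fun t => P1 t *: varsigma1 vac I (gamma t)) gamma_pochhammer l0_log l1_log.
  - congr (_ *: _); rewrite varsigma1E !big_ord_recl big_ord0 /= /e /=.
    move: (gamma t)^-1 (gamma t - 1)^-1 => p q.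
    rewrite addr0 !scalerDr !scalerA !expr0 !mulr1 !mul1r addrA !expr1.
    by congr (_ *: _ + _ *: _ + _ *: _); field.
  - rewrite fE2 addrK (_ : _ * _ = (k1 + k2) * (k1 + k2 - M%:R) / M%:R ^+ 2).
      by rewrite !mulf_neq0// invr_eq0 expf_neq0.
    by field.
  - exact: hJ.
  set x := _ * k1; set y := _ * k2; rewrite !fE2 => + + ->.
  (* The identity of coefficients is rational in M and in the exponents x, y. *)
  have k1E : k1 = - M%:R * x by rewrite /x; field.
  have k2E : k2 = - M%:R * y by rewrite /y; field.
  clearbody x y.
  rewrite !mulf_eq0 !negb_or => /andP[x0 x1] /andP[y0 y1].
  rewrite omega_stateE !big_ord_recl big_ord0 /= /e /= addr0.
  rewrite !subn0 subnn subSS subn0 !fE0 !fE1 !fE2 !scalerDr !scalerA -scaleNr.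
  rewrite [LHS]addrAC -[LHS]addrA.
  rewrite k1E k2E in h1 h2 h3 *.
  have n1 : - M%:R * x + M%:R != 0.
    by rewrite (_ : _ + _ = - M%:R * (x - 1)) ?mulf_neq0 ?oppr_eq0//; ring.
  have n2 : - M%:R * y + M%:R != 0.
    by rewrite (_ : _ + _ = - M%:R * (y - 1)) ?mulf_neq0 ?oppr_eq0//; ring.
  congr (_ *: _ + (_ *: _ + _ *: _)).
  - by field; rewrite x0 x1 h1 h2 h3 n1.
  - by field; rewrite x0 y0 h1 h2 h3.
  - by field; rewrite y0 y1 h1 h2 h3 n2.
- move=> h1 h2 h3 h4 h5 hJ D _.
  pose e := nth 0 [:: 3^-1 *: cubic vac I ord0 ord0 ord0;
    cubic vac I ord0 ord0 ord_max; cubic vac I ord0 ord_max ord_max;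
    3^-1 *: cubic vac I ord_max ord_max ord_max].
  have [t t01|||] := @normalized_contour_integral R V k1 k2
      (- (2 / M%:R)) gamma l0 l1 3 e
    (fun t => P2 t *: varsigma2 vac I (gamma t)) gamma_pochhammer l0_log l1_log.
  - congr (_ *: _); rewrite varsigma2E !big_ord_recl big_ord0 /= /e /=.
    move: (gamma t)^-1 (gamma t - 1)^-1 => p q.
    rewrite addr0 !scalerDr !scalerA !expr0 !mulr1 !mul1r !addrA !expr1.
    by congr (_ *: _ + _ *: _ + _ *: _ + _ *: _); field.
  - by rewrite [_ * k2]mulNr.
  - exact: hJ.
  move: h5; rewrite -[- (2 / M%:R * k2)]mulNr W_stateE /kappa.
  set x := _ * k1; set y := _ * k2; set S := ffactr _ 3.
  clearbody x y S; move=> S0 + + ->.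
  rewrite !big_ord_recl big_ord0 /= /e /= addr0 !subn0 subnn !subSS ?subn0.
  rewrite !fE0 !fE1 !fE2 !fE3.
  rewrite !mulf_eq0 !negb_or => /andP[/andP[x0 x1] x2] /andP[/andP[y0 y1] y2].
  have distr (c a1 a2 a3 a4 : R[i]) (v1 v2 v3 v4 : V) :
      c *: (a1 *: v1 - a2 *: v2 + a3 *: v3 - a4 *: v4) = (c * a1) *: v1 +
        ((- (c * a2)) *: v2 + ((c * a3) *: v3 + (- (c * a4)) *: v4)).
    by rewrite !scaleNr -!scalerA !scalerDr !scalerN -!addrA.
  rewrite distr !scalerDr !scalerA.
  congr (_ *: _ + (_ *: _ + (_ *: _ + _ *: _))).
  - by field; rewrite x0 x1 x2 S0.
  - by field; rewrite x0 x1 y0 S0.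
  - by field; rewrite x0 y0 y1 S0.
  - by field; rewrite y0 y1 y2 S0.
Qed.
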